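(* If $\bm v_h\in V_h$ satisfies $$b_h(\bm v_h,q)=0\qquad\forall\,q\in Q_h^0,$$ then $\bm v_h\in H(\mathrm{div};\Omega)$ and $\bm v_h$ is divergence-free, i.e. $\nabla\cdot\bm v_h=0$ in $\Omega$.
   Context: Domain and mesh. $\Omega\subset\mathbb R^2$ is a bounded simply connected polygonal domain with Lipschitz boundary. $\mathcal S$ is a partition of $\Omega$ into star-shaped polygons; $\mathcal F_{pr}$ is the set of edges of these polygons (primal edges) and $\mathcal F_{pr}^0$ the interior ones. In each polygon an interior point of its kernel is chosen and joined to all its vertices; this yields a triangulation $\mathcal T_h$, and the new edges are the dual edges $\mathcal F_{dl}$. Notation. Each edge $e$ has a fixed unit normal $\mathbf n$ (the outward normal of one adjacent triangle $\tau_+$). On interior edges $[\![v]\!]=v|_{\tau_+}-v|_{\tau_-}$; on boundary edges $[\![v]\!]=v|_{\tau_+}$. $(\cdot,\cdot)_\tau$ is the $L^2(\tau)$ and $\langle\cdot,\cdot\rangle_e$ the $L^2(e)$ inner product. $H(\mathrm{div};\Omega)=\{\bm v\in[L^2(\Omega)]^2:\nabla\cdot\bm v\in L^2(\Omega)\}$. Discrete spaces ($k\ge0$ integer, $\mathbb P_k(\mathcal T_h)$ = functions that are polynomials of degree $\le k$ on each triangle): $V_h=\{\bm v\in[\mathbb P_k(\mathcal T_h)]^2: [\![\bm v\cdot\mathbf n]\!]_e=0\ \forall e\in\mathcal F_{dl}\}$, $Q_h=\{q\in\mathbb P_k(\mathcal T_h): [\![q]\!]_e=0\ \forall e\in\mathcal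 F_{pr}^0\}$, $Q_h^0=\{q\in Q_h:\int_\Omega q=0\}$. Form: $b_h(\bm v,q)=-\sum_{\tau\in\mathcal T_h}(\bm v,\nabla q)_\tau+\sum_{e\in\mathcal F_{dl}}\langle\bm v\cdot\mathbf n,[\![q]\!]\rangle_e$. *)

(* Defs.v *)
From HB Require Import structures.
From mathcomp Require Import all_boot all_order all_algebra.
From mathcomp Require Import all_classical all_reals all_analysis.

Set Implicit Arguments.
Unset Strict Implicit.
Unset Printing Implicit Defensive.

Import Order.TTheory GRing.Theory Num.Theory.
Import numFieldNormedType.Exports.

Local Open Scope classical_set_scope.
Local Open Scope ring_scope.

(* Points and vectors of the plane are pairs.  The library norm of [R * R] is
   the sup norm, so Euclidean lengths are spelled out with [eucl]; topology,
   boundedness and differentiability do not depend on that choice. *)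

Definition dot (R : realType) (x y : R * R) : R := x.1 * y.1 + x.2 * y.2.

Definition eucl (R : realType) (x : R * R) : R := Num.sqrt (dot x x).

Definition mu2 (R : realType) :=
  ((@lebesgue_measure R) \x (@lebesgue_measure R))%E.

Definition seg (R : realType) (a b : R * R) : set (R * R) :=
  [set x | exists2 t : R, 0 <= t <= 1 & x = (1 - t) *: a + t *: b].

Definition triangle (R : realType) (a b c : R * R) : set (R * R) :=
  [set x | exists r s t : R, [/\ 0 <= r, 0 <= s, 0 <= t, r + s + t = 1 &
     x = r *: a + s *: b + t *: c]].

Definition bnd (R : realType) (A : set (R * R)) : set (R * R) :=
  closure A `\` A°.

(* The integral of [f] over the segment [a, b] for arc length. *)
Definition seg_int (R : realType) (a b : R * R) (f : R * R -> R) : R :=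
  eucl (b - a) *
  Rintegral (@lebesgue_measure R) `[0, 1] (fun t => f ((1 - t) *: a + t *: b)).

Definition grad (R : realType) (f : R * R -> R) (x : R * R) : R * R :=
  ('D_(1, 0) f x, 'D_(0, 1) f x).

Definition is_poly (R : realType) (k : nat) (f : R * R -> R) : Prop :=
  exists c : nat -> nat -> R, forall x,
    f x = \sum_(i < k.+1) \sum_(j < k.+1 | (i + j <= k)%N)
            c i j * x.1 ^+ i * x.2 ^+ j.

Definition simply_connected (R : realType) (A : set (R * R)) : Prop :=
  (forall x y, A x -> A y -> exists g : R -> R * R,
     [/\ {within [set t : R | 0 <= t <= 1], continuous g}, g 0 = x, g 1 = y &
         forall t, 0 <= t <= 1 -> A (g t)]) /\
  (forall g : R -> R * R,
     {within [set t : R | 0 <= t <= 1], continuous g} ->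
     (forall t, 0 <= t <= 1 -> A (g t)) -> g 0 = g 1 ->
     exists H : R * R -> R * R,
       [/\ {within [set s : R | 0 <= s <= 1] `*` [set t : R | 0 <= t <= 1],
             continuous H},
           forall s t, 0 <= s <= 1 -> 0 <= t <= 1 -> A (H (s, t)),
           forall t, 0 <= t <= 1 -> H (0, t) = g t,
           forall t, 0 <= t <= 1 -> H (1, t) = g 0 &
           forall s, 0 <= s <= 1 -> H (s, 0) = g 0 /\ H (s, 1) = g 0]).

(* Near each boundary point, in the orthonormal frame made of [u] and of [u]
   rotated by a right angle, [A] is the set above the graph of a Lipschitz
   function. *)
Definition lipschitz_boundary (R : realType) (A : set (R * R)) : Prop :=
  forall x, bnd A x ->
  exists (u : R * R) (r L : R) (g : R -> R),
    [/\ eucl u = 1, 0 < r, L.-lipschitz g &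
        forall y, eucl (y - x) < r ->
          (A y <-> g (dot u (y - x)) < dot (- u.2, u.1) (y - x))].

Definition polygonal_boundary (R : realType) (A : set (R * R)) : Prop :=
  exists s : seq ((R * R) * (R * R)),
    bnd A = [set x | exists2 e, e \in s & seg e.1 e.2 x].

Definition polygonal_domain (R : realType) (Om : set (R * R)) : Prop :=
  [/\ Om !=set0 /\ open Om, bounded_set Om, simply_connected Om,
      polygonal_boundary Om & lipschitz_boundary Om].

(* [P] is the closed polygon with vertices [v 0, ..., v (n - 1)] in cyclic
   order: the edges form a simple closed curve J and P is the compact region
   it encloses.  Since P is the closure of its interior and has boundary J, its
   interior is a bounded nonempty union of components of the complement of J,
   that is, the inside of J.  Straight angles at vertices are allowed. *)
Definition is_polygon (R : realType) (n : nat) (v : 'I_n -> R * R)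
    (P : set (R * R)) : Prop :=
  [/\ (3 <= n)%N, injective v,
      forall j j' : 'I_n, j != j' ->
        seg (v j) (v (ordS j)) `&` seg (v j') (v (ordS j')) `<=`
        [set v j; v (ordS j)] `&` [set v j'; v (ordS j')],
      compact P /\ P = closure P° &
      bnd P = \bigcup_j seg (v j) (v (ordS j))].

Definition kernel (R : realType) (P : set (R * R)) : set (R * R) :=
  [set x | P x /\ forall y, P y -> seg x y `<=` P].

(* A star-shaped polygonal partition of [Om].  The cell [i] is the closed
   polygon [region i], with vertices [vtx i 0, ..., vtx i (nv i - 1)] in cyclic
   order; [nu i] is the point chosen in the interior of its kernel.  By
   [mesh_conform] a vertex on the boundary of a cell is a vertex of that cell
   (a hanging node is a vertex with straight angle), so two polygons meet along
   common edges and vertices. *)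
Record mesh (R : realType) (Om : set (R * R)) := Mesh {
  cell : finType;
  nv : cell -> nat;
  vtx : forall i : cell, 'I_(nv i) -> R * R;
  region : cell -> set (R * R);
  nu : cell -> R * R;
  mesh_polygon : forall i, is_polygon (@vtx i) (region i);
  mesh_star : forall i, (kernel (region i))° (nu i);
  mesh_cover : closure Om = \bigcup_i region i;
  mesh_disj : forall i i', i != i' -> (region i)° `&` (region i')° = set0;
  mesh_conform : forall i i' (j : 'I_(nv i)) (j' : 'I_(nv i')),
    seg (vtx j) (vtx (ordS j)) = seg (vtx j') (vtx (ordS j')) \/
    seg (vtx j) (vtx (ordS j)) `&` seg (vtx j') (vtx (ordS j')) `<=`
      [set vtx j; vtx (ordS j)] `&` [set vtx j'; vtx (ordS j')] }.

(* The triangles of T_h are indexed by pairs (i, j), standing for the triangle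
   spanned by [nu i] and by the edge of the cell [i] from its vertex [j] to the
   next one.  The same pairs index the dual edges, from [nu i] to the vertex
   [j]. *)
Definition tri (R : realType) (Om : set (R * R)) (M : mesh Om) : finType :=
  {i : cell M & 'I_(nv i)}.

Section Mesh.
Context (R : realType) (Om : set (R * R)) (M : mesh Om).
Implicit Types (t : tri M) (e : set (R * R)).

Definition apex t : R * R := nu (tag t).
Definition vert1 t : R * R := vtx (tagged t).
Definition vert2 t : R * R := vtx (ordS (tagged t)).

Definition tri_set t : set (R * R) := triangle (apex t) (vert1 t) (vert2 t).

Definition tri_edge t e : Prop :=
  [\/ e = seg (vert1 t) (vert2 t), e = seg (apex t) (vert1 t) |
      e = seg (apex t) (vert2 t)].

Definition dual_edge t : set (R * R) := seg (apex t) (vert1 t).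

Definition primal_edges : set (set (R * R)) :=
  [set seg (vert1 t) (vert2 t) | t in [set: tri M]].
Definition dual_edges : set (set (R * R)) :=
  [set dual_edge t | t in [set: tri M]].
Definition interior_primal_edges : set (set (R * R)) :=
  [set e | primal_edges e /\ ~ (e `<=` bnd Om)].

Definition outward_normal t e (n : R * R) : Prop :=
  [/\ eucl n = 1, forall x y, e x -> e y -> dot n (y - x) = 0 &
      forall x y, e x -> tri_set t y -> dot n (y - x) <= 0].

(* [tau_plus e] and [nrm e] are constrained for the edges of T_h only. *)
Record orientation := Orientation {
  tau_plus : set (R * R) -> tri M;
  nrm : set (R * R) -> R * R;
  orient_edge : forall e, (primal_edges `|` dual_edges) e ->
    tri_edge (tau_plus e) e;
  orient_nrm : forall e, (primal_edges `|` dual_edges) e ->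
    outward_normal (tau_plus e) e (nrm e) }.

(* A broken function is the family of its restrictions to the triangles, which
   makes its traces on the edges unambiguous.  The restrictions are polynomials
   below, identified with their extensions to the whole plane. *)

Definition jump (o : orientation) e (q : tri M -> R * R -> R) (x : R * R) : R :=
  q (tau_plus o e) x -
  (if [pick t | (t != tau_plus o e) && `[< tri_edge t e >]] is Some t
   then q t x else 0).

(* The function on Om of a broken function, set to 0 on the skeleton, which is
   a null set. *)
Definition glue (q : tri M -> R * R -> R) (x : R * R) : R :=
  \sum_(t : tri M | `[< (tri_set t)° x >]) q t x.

Definition glue_vec (v : tri M -> R * R -> R * R) (x : R * R) : R * R :=
  (glue (fun t y => (v t y).1) x, glue (fun t y => (v t y).2) x).

Definition Pk (k : nat) (q : tri M -> R * R -> R) : Prop :=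
  forall t, is_poly k (q t).

Definition Vh (o : orientation) (k : nat) (v : tri M -> R * R -> R * R) : Prop :=
  [/\ Pk k (fun t y => (v t y).1), Pk k (fun t y => (v t y).2) &
      forall e, dual_edges e -> forall x, e x ->
        jump o e (fun t y => dot (v t y) (nrm o e)) x = 0].

Definition Qh (o : orientation) (k : nat) (q : tri M -> R * R -> R) : Prop :=
  Pk k q /\
  forall e, interior_primal_edges e -> forall x, e x -> jump o e q x = 0.

Definition Qh0 (o : orientation) (k : nat) (q : tri M -> R * R -> R) : Prop :=
  Qh o k q /\ Rintegral (@mu2 R) Om (glue q) = 0.

(* On dual edges the normal trace of [v] in [Vh] is single-valued; it is taken
   here from tau_+. *)
Definition bh (o : orientation) (v : tri M -> R * R -> R * R)
    (q : tri M -> R * R -> R) : R :=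
  - (\sum_(t : tri M)
       Rintegral (@mu2 R) (tri_set t) (fun x => dot (v t x) (grad (q t) x))) +
  \sum_(d : tri M)
    seg_int (apex d) (vert1 d)
      (fun x => let e := dual_edge d in
         dot (v (tau_plus o e) x) (nrm o e) * jump o e q x).

End Mesh.

Fixpoint Cdiff (R : realType) (m : nat) (f : R * R -> R) : Prop :=
  if m is m'.+1 then
    (forall x, differentiable f x) /\ forall u, Cdiff m' ('D_u f)
  else continuous f.

Definition test_fun (R : realType) (Om : set (R * R)) (phi : R * R -> R) : Prop :=
  [/\ forall m, Cdiff m phi, compact (closure [set x | phi x != 0]) &
      closure [set x | phi x != 0] `<=` Om].

Definition L2 (R : realType) (Om : set (R * R)) (f : R * R -> R) : Prop :=
  (f \_ Om : measurableTypeR R * measurableTypeR R -> R) \in Lfun (@mu2 R) 2%:E.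

(* [g] is the divergence of [w] in the sense of distributions on [Om]. *)
Definition weak_div (R : realType) (Om : set (R * R)) (w : R * R -> R * R)
    (g : R * R -> R) : Prop :=
  forall phi, test_fun Om phi ->
    Rintegral (@mu2 R) Om (fun x => dot (w x) (grad phi x)) =
    - Rintegral (@mu2 R) Om (fun x => g x * phi x).

Definition Hdiv (R : realType) (Om : set (R * R)) (w : R * R -> R * R) : Prop :=
  [/\ L2 Om (fun x => (w x).1), L2 Om (fun x => (w x).2) &
      exists2 g, L2 Om g & weak_div Om w g].

(* Main.v *)
Require Import Defs.
From mathcomp Require Import all_boot all_order all_algebra.
From mathcomp Require Import all_classical all_reals all_analysis.
From mathcomp Require Import ring lra.

(** The form [bh] is integrated by parts on every triangle ([triangle_parts]). A
dual edge belongs to two triangles of one cell, which lie on opposite sides of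
it ([tri_edge_dual], [dual_opposite]), and the normal component of [v] is
continuous across it. The dual edges therefore cancel and [bh] becomes, for every
family [q] of continuously differentiable functions ([bh_parts]), the sum over
the triangles of the integral of [div v * q] minus the flux of [q v] through the
primal edge of the triangle.

Since [bh] does not see constants, it vanishes on all of [Qh] and not just on the
functions with mean zero ([bh_Qh]). As each triangle has one primal edge, [Qh]
contains two families of test functions of small support. The function equal to
[L * div v] on one triangle, with [L] the barycentric coordinate that vanishes on
the primal edge, gives [div v = 0] on that triangle ([div_zero]). The function
equal to the polynomial jump of [v] in the normal direction on the two triangles
at a primal edge shows that this jump is zero on the edge ([flux_pair]).

Now let [q] be a smooth function [f] with support in [Om], the same on all
triangles. In the formula of [bh_parts] the divergences are zero, the fluxes
cancel in pairs at interior primal edges, and [f] vanishes at the others, so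
[bh v f = 0] ([bh_smooth]). As [f] does not jump, [bh v f] is by definition minus
the integral of [v] against the gradient of [f]: the weak divergence is zero.

The divergence theorem is obtained from Fubini and the fundamental theorem of
calculus on the horizontal slices of a triangle ([slice_integral], [green1]). The
geometric facts on the mesh rest on [star_interior]: every point strictly between
the chosen kernel point and a point of the cell is interior to the cell. Thus
rays from the kernel point leave the cell at the boundary ([ray_bnd]), the
triangles are not degenerate ([tri_det]), and just behind an interior primal edge
there is another cell ([primal_neighbour]). *)

Set Implicit Arguments.
Unset Strict Implicit.
Unset Printing Implicit Defensive.

Import Order.TTheory GRing.Theory Num.Theory.
Import numFieldNormedType.Exports.

Local Open Scope classical_set_scope.
Local Open Scope ring_scope.

Local Notation plane R := (measurableTypeR R * measurableTypeR R)%type.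
Local Notation leb R := (@lebesgue_measure R).

(** * Coordinates of the plane *)

Section Coordinates.
Context (R : realType).
Implicit Types (a b : R * R) (k : R).

Lemma fst_scale k a : (k *: a).1 = k * a.1. Proof. by []. Qed.
Lemma snd_scale k a : (k *: a).2 = k * a.2. Proof. by []. Qed.
Lemma fst_add a b : (a + b).1 = a.1 + b.1. Proof. by []. Qed.
Lemma snd_add a b : (a + b).2 = a.2 + b.2. Proof. by []. Qed.
Lemma fst_opp a : (- a).1 = - a.1. Proof. by []. Qed.
Lemma snd_opp a : (- a).2 = - a.2. Proof. by []. Qed.

Definition coordE := (fst_add, snd_add, fst_opp, snd_opp, fst_scale, snd_scale).

Lemma plane_eq a b : a.1 = b.1 -> a.2 = b.2 -> a = b.
Proof. by move: a b => [? ?] [? ?] /= -> ->. Qed.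

End Coordinates.

(** * Measurability and integrability in the plane *)

Section PlaneMeasure.
Context (R : realType).
Implicit Types (f g : R * R -> R) (a b c x y : R * R) (D : set (R * R)).

Definition box (q : R * R) (r : R) : set (R * R) :=
  `]q.1 - r, q.1 + r[%classic `*` `]q.2 - r, q.2 + r[%classic.

Lemma box_ball (q : R * R) (r : R) x : box q r x <-> ball q r x.
Proof.
rewrite /box /ball /= /prod_ball /ball /= !in_itv /= -!ltr_distlC.
by split => -[].
Qed.

Lemma measurable_box (q : R * R) (r : R) : measurable (box q r : set (plane R)).
Proof. by apply: measurableX; exact: measurable_itv. Qed.

(** The product sigma-algebra is generated by rectangles; an open set is the union
of the countably many squares with rational centre and radius [n.+1%:R^-1] that
it contains. *)
Lemma measurable_open D : open D -> measurable (D : set (plane R)).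
Proof.
move=> oD.
pose I : Type := (rat * rat * nat)%type.
pose F (i : I) : set (plane R) :=
  let B := box (ratr i.1.1, ratr i.1.2) (i.2.+1%:R^-1) in
  if `[< B `<=` D >] then B else set0.
have -> : D = \bigcup_i F i.
  apply/seteqP; split=> x; last first.
    by case=> i _; rewrite /F; case: asboolP => // + Bx; exact.
  move=> Dx; move/open_nbhs_nbhs: (conj oD Dx) => /nbhs_ballP[e /= e0 eD].
  (* a square of radius [h] that contains [x] lies in the ball of radius [2 h] *)
  pose n := Num.truncn (2 / e).
  have [h [hE h0 he]] : exists h : R, [/\ n.+1%:R^-1 = h, 0 < h & h + h < e].
    exists n.+1%:R^-1; split => //.
    have : 2 / e < n.+1%:R by rewrite truncnS_gt.
    rewrite ltr_pdivrMr// => h.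
    by rewrite -mulr2n -(mulr_natl _ 2) ltr_pdivrMr ?ltr0n// mulrC.
  have [p1] := @rat_in_itvoo R (x.1 - h) x.1 ltac:(lra).
  rewrite in_itv/= => /andP[h1 h1'].
  have [p2] := @rat_in_itvoo R (x.2 - h) x.2 ltac:(lra).
  rewrite in_itv/= => /andP[h2 h2'].
  exists (p1, p2, n) => //; rewrite /F /= hE; case: asboolP.
    by move=> _; split; rewrite /= in_itv /=; apply/andP; split; lra.
  case=> y -[/=]; rewrite !in_itv/= => /andP[y1 y1'] /andP[y2 y2'].
  apply: eD; apply/box_ball; split; rewrite /= in_itv /=; apply/andP; split; lra.
apply: countable_bigcupT_measurable => [|i]; first exact: countableP.
by rewrite /F; case: ifP => // _; exact: measurable_box.
Qed.

Lemma measurable_closed D : closed D -> measurable (D : set (plane R)).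
Proof. by move/closed_openC/measurable_open/measurableC; rewrite setCK. Qed.

Lemma continuous_measurable2 f : continuous f ->
  measurable_fun (setT : set (plane R)) f.
Proof.
move/continuousP => cf; apply: (measurability _ (measurable_realfun.RGenOpens.measurableE R)).
move=> _ [_ [a [b ->] <-]]; rewrite setTI.
by apply: measurable_open; exact/cf/interval_open.
Qed.

Definition square (K : R) : set (R * R) := `[- K, K]%classic `*` `[- K, K]%classic.

Lemma square_finite (K : R) : (@mu2 R (square K : set (plane R)) < +oo)%E.
Proof.
have mI : (leb R (`[- K, K]%classic)%R < +oo)%E.
  by rewrite lebesgue_measure_itv/=; case: ifP => _; rewrite // -EFinD ltry.
rewrite /mu2 /square product_measure1E; [|exact: measurable_itv..].
by apply: lte_mul_pinfty => //; rewrite ge0_fin_numE.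
Qed.

Lemma measurable_square (K : R) : measurable (square K : set (plane R)).
Proof. by apply: measurableX; exact: measurable_itv. Qed.

Lemma bounded_square D : bounded_set D -> exists K, D `<=` square K.
Proof.
move=> [K [_ HK]]; exists (K + 1) => x Dx.
have : `|x| <= K + 1 by apply: (HK (K + 1)) => //; lra.
rewrite prod_normE ge_max => /andP[h1 h2].
by split; rewrite /= in_itv /= -ler_norml.
Qed.

Lemma continuous_integrable2 f D : continuous f ->
  measurable (D : set (plane R)) -> bounded_set D ->
  (@mu2 R).-integrable (D : set (plane R)) (EFin \o f).
Proof.
move=> cf mD /bounded_square[K DK].
apply: (integrableS (measurable_square K)) => //.
apply: measurable_bounded_integrable.
- exact: measurable_square.
- exact: square_finite.
- by apply: measurable_funS (continuous_measurable2 cf).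
- have cpt : compact (square K).
    by apply: compact_setX; exact: segment_compact.
  have /compact_bounded[M [_ mrt]] :=
    continuous_compact (continuous_subspaceT cf) cpt.
  by exists M; split; rewrite ?num_real // => ? ? ? ?; exact: mrt.
Qed.

End PlaneMeasure.

(** * Integrals along segments *)

Section Segments.
Context (R : realType).
Implicit Types (f g : R * R -> R) (a b c x y : R * R).

(** Unlike [seg_int], this integral has no length factor: the length is absorbed in
the normal vectors, and no square root enters the divergence theorem. *)
Definition lint a b f : R :=
  Rintegral (leb R) `[0, 1] (fun t => f ((1 - t) *: a + t *: b)).

Lemma cts_affine a b : continuous (fun t : R => (1 - t) *: a + t *: b : R * R).
Proof.
move=> t; apply: cvgD; apply: cvgZr_tmp; last exact: cvg_id.
by apply: cvgB; [exact: cvg_cst|exact: cvg_id].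
Qed.

Lemma cts_along a b f : continuous f ->
  continuous (fun t : R => f ((1 - t) *: a + t *: b)).
Proof.
move=> cf t; apply: (@continuous_comp _ _ _ (fun t : R => (1 - t) *: a + t *: b) f).
  exact: cts_affine.
exact: cf.
Qed.

Lemma integrable_itv (h : R -> R) (p q : R) : continuous h ->
  (leb R).-integrable `[p, q] (EFin \o h).
Proof.
move=> ch; apply: continuous_compact_integrable; first exact: segment_compact.
exact: continuous_subspaceT.
Qed.

Lemma integrable_along a b f : continuous f ->
  (leb R).-integrable `[0, 1] (EFin \o (fun t => f ((1 - t) *: a + t *: b))).
Proof. by move=> cf; apply: integrable_itv; exact: cts_along. Qed.

Lemma eq_lint a b f g : (forall x, seg a b x -> f x = g x) ->
  lint a b f = lint a b g.
Proof.
move=> fg; apply: eq_Rintegral => t; rewrite inE /= in_itv /= => t01.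
by apply: fg; exists t.
Qed.

Lemma lint0 a b f : (forall x, seg a b x -> f x = 0) -> lint a b f = 0.
Proof.
move=> f0; rewrite (@eq_lint a b f (fun=> 0)) //.
by rewrite /lint /Rintegral integral0.
Qed.

Lemma lintD a b f g : continuous f -> continuous g ->
  lint a b (fun x => f x + g x) = lint a b f + lint a b g.
Proof. by move=> cf cg; rewrite /lint RintegralD//; exact: integrable_along. Qed.

Lemma lintZ a b f (k : R) : continuous f ->
  lint a b (fun x => k * f x) = k * lint a b f.
Proof. by move=> cf; rewrite /lint RintegralZl//; exact: integrable_along. Qed.

Lemma lintC a b f : continuous f -> lint a b f = lint b a f.
Proof.
move=> cf; rewrite /lint Rintegration_by_substitution_onem; first last.
- exact/continuous_subspaceT/cts_along.
- by rewrite ler01 lexx.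
rewrite /unstable.onem subrr; apply: eq_Rintegral => t _.
by rewrite opprB addrCA subrr addr0 addrC.
Qed.

Lemma FTC2_le (F g : R -> R) (u w : R) : continuous g ->
  (forall x : R, is_derive x 1 F (g x)) -> u <= w ->
  Rintegral (leb R) `[u, w] g = F w - F u.
Proof.
move=> cg dF; rewrite le_eqVlt => /predU1P[->|uw].
  by rewrite set_itv1 Rintegral_set1 subrr.
have dF1 (x : R) : derivable F x 1 by have := dF x => h; apply: ex_derive.
have cF (x : R) : F @ x --> F x.
  by apply: differentiable_continuous; apply/derivable1_diffP.
rewrite /Rintegral (@continuous_FTC2 _ g F u w)//.
- exact: continuous_subspaceT.
- split => //; [exact: cvg_at_right_filter|exact: cvg_at_left_filter].
- by move=> x _; rewrite derive1E; have := dF x => h; apply: derive_val.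
Qed.

Lemma Rintegral_rescale (h : R -> R) (p q : R) : continuous h -> p < q ->
  Rintegral (leb R) `[p, q] h =
  (q - p) * Rintegral (leb R) `[0, 1] (fun t => h ((1 - t) * p + t * q)).
Proof.
move=> ch pq; pose F : R -> R := fun t => (1 - t) * p + t * q.
have dF (t : R) : is_derive t (1 : R) F (q - p).
  have -> : F = (fun t => p + t * (q - p)) by apply/funext => s; rewrite /F; ring.
  by apply: is_derive_eq; rewrite scaler0 !add0r mul1r -[LHS]/((q - p) * 1) mulr1.
have cF : continuous F.
  move=> s; apply: differentiable_continuous; apply/derivable1_diffP.
  by have := dF s => ?; apply: ex_derive.
have F' : derive1 F = cst (q - p).
  by apply/funext => t; rewrite derive1E; have := dF t => ?; apply: derive_val.
have := @integration_by_substitution_increasing R F h 0 1 ler01.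
have -> : F 0 = p by rewrite /F; ring.
have -> : F 1 = q by rewrite /F; ring.
move=> sub; rewrite /Rintegral sub; first last.
- exact: continuous_subspaceT.
- split=> [s _||]; first by have := dF s => ?; apply: ex_derive.
    exact/cvg_at_right_filter/cF.
  exact/cvg_at_left_filter/cF.
- by rewrite F'; exact: is_cvg_cst.
- by rewrite F'; exact: is_cvg_cst.
- by rewrite F' => ? ?; exact: cvg_cst.
- by move=> s t _ _ st; rewrite /F; nra.
rewrite -[LHS]/(Rintegral (leb R) `[0, 1] _) F' -RintegralZl//.
  by apply: eq_Rintegral => t _; rewrite mulrC.
apply: integrable_itv => t; apply: continuous_comp; [exact: cF|exact: ch].
Qed.

End Segments.

(** * Triangles and barycentric coordinates *)

Section Triangles.
Context (R : realType).
Implicit Types (f g : R * R -> R) (a b c x : R * R).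

Definition det a b c : R :=
  (b.1 - a.1) * (c.2 - a.2) - (b.2 - a.2) * (c.1 - a.1).

Lemma det_cycle a b c : det b c a = det a b c.
Proof. rewrite /det; ring. Qed.

Lemma det_flip a b c : det b a c = - det a b c.
Proof. rewrite /det; ring. Qed.

Lemma det_sum x a b c : det x b c + det a x c + det a b x = det a b c.
Proof. rewrite /det; ring. Qed.

Lemma triangle_cycle a b c : triangle b c a = triangle a b c.
Proof.
apply/seteqP; split=> x [r [s [t [r0 s0 t0 e ->]]]].
  by exists t, r, s; split => //; [rewrite -e; ring|rewrite addrC addrA].
by exists s, t, r; split => //; [rewrite -e; ring|rewrite -addrA addrC].
Qed.

Lemma triangle_flip a b c : triangle b a c = triangle a b c.
Proof.
apply/seteqP; split=> x [r [s [t [r0 s0 t0 e ->]]]].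
  by exists s, r, t; split => //; [rewrite -e; ring|rewrite [_ + r *: _]addrC].
by exists s, r, t; split => //; [rewrite -e; ring|rewrite [_ + r *: _]addrC].
Qed.

Lemma seg_triangle a b c : seg a b `<=` triangle a b c.
Proof.
move=> x [t /andP[t0 t1] ->]; exists (1 - t), t, 0; split => //.
- by rewrite subr_ge0.
- by ring.
- by rewrite scale0r addr0.
Qed.

Lemma bary_comb x a b c : det a b c != 0 ->
  x = (det x b c / det a b c) *: a + (det a x c / det a b c) *: b +
      (det a b x / det a b c) *: c.
Proof.
rewrite /det => d0; apply: plane_eq; rewrite !coordE; field; exact: d0.
Qed.

Lemma bary_det (r s t : R) a b c : r + s + t = 1 ->
  let x := r *: a + s *: b + t *: c in
  [/\ det x b c = r * det a b c, det a x c = s * det a b c &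
      det a b x = t * det a b c].
Proof.
move=> e; have {e}-> : r = 1 - s - t by rewrite -e; ring.
by move=> x; rewrite /x /det !coordE; split; ring.
Qed.

Lemma triangleP a b c x : det a b c != 0 ->
  triangle a b c x <-> [/\ 0 <= det x b c / det a b c,
    0 <= det a x c / det a b c & 0 <= det a b x / det a b c].
Proof.
move=> d0; split.
  move=> [r [s [t [r0 s0 t0 e ->]]]].
  by have [-> -> ->] := bary_det a b c e; rewrite !mulfK.
move=> [h1 h2 h3]; exists (det x b c / det a b c), (det a x c / det a b c),
  (det a b x / det a b c); split => //; last exact: bary_comb.
by rewrite -!mulrDl det_sum divff.
Qed.

Lemma cts_det1 b c : continuous (fun x => det x b c).
Proof.
move=> x; rewrite /det; apply: cvgB; apply: cvgM; apply: cvgB;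
  try exact: cvg_cst; (apply: cvg_fst || apply: cvg_snd).
Qed.

Lemma cts_det2 a c : continuous (fun x => det a x c).
Proof. by under eq_fun do rewrite -det_cycle; exact: cts_det1. Qed.

Lemma cts_det3 a b : continuous (fun x => det a b x).
Proof. by under eq_fun do rewrite -det_cycle; exact: cts_det2. Qed.

Lemma triangle_closed a b c : det a b c != 0 -> closed (triangle a b c).
Proof.
move=> d0.
have -> : triangle a b c = (fun x => det x b c / det a b c) @^-1` [set y | 0 <= y] `&`
   ((fun x => det a x c / det a b c) @^-1` [set y | 0 <= y] `&`
   (fun x => det a b x / det a b c) @^-1` [set y | 0 <= y]).
  apply/seteqP; split => x.
    by move/(triangleP x d0) => -[].
  by move=> [? [? ?]]; apply/triangleP.
by repeat apply: closedI; apply: preimage_closed; rewrite ?closed_ge //;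
  move=> ? _; apply: cvgMr_tmp; (apply: cts_det1 || apply: cts_det2 || apply: cts_det3).
Qed.

Lemma triangle_bounded a b c : bounded_set (triangle a b c).
Proof.
exists (`|a| + `|b| + `|c|); split; first by rewrite num_real.
move=> M hM x [r [s [t [r0 s0 t0 e ->]]]].
have h (k : R) (z : R * R) : 0 <= k <= 1 -> `|k *: z| <= `|z|.
  move=> /andP[k0 k1]; rewrite normrZ ger0_norm//.
  by rewrite ler_piMl.
apply: (le_trans (ler_normD _ _)); apply: le_trans (ltW hM); apply: lerD.
  apply: (le_trans (ler_normD _ _)); apply: lerD; apply: h; lra.
by apply: h; lra.
Qed.

Lemma measurable_triangle a b c : det a b c != 0 ->
  measurable (triangle a b c : set (plane R)).
Proof. by move/triangle_closed/measurable_closed. Qed.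

Lemma integrable_triangle a b c f : det a b c != 0 -> continuous f ->
  (@mu2 R).-integrable (triangle a b c : set (plane R)) (EFin \o f).
Proof.
move=> d0 cf; apply: continuous_integrable2 => //.
  exact: measurable_triangle.
exact: triangle_bounded.
Qed.

End Triangles.

(** * Crossing a horizontal line *)

Section Green.
Context (R : realType).
Implicit Types (f g : R * R -> R) (a b c x : R * R).

(** Abscissa at which the line through [a] and [b] meets the height [y]. *)
Definition crossing a b (y : R) : R :=
  a.1 + (y - a.2) / (b.2 - a.2) * (b.1 - a.1).

(** The value of [f] where the segment crosses the height [y], signed by the
direction of the crossing, so that integrating over [y] gives the integral of
[f] against the second coordinate along the oriented segment. *)
Definition crossed a b f (y : R) : R :=
  if a.2 < y < b.2 then f (crossing a b y, y) else
  if b.2 < y < a.2 then - f (crossing a b y, y) else 0.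

Lemma crossingC a b (y : R) : a.2 != b.2 -> crossing a b y = crossing b a y.
Proof.
move=> ab; rewrite /crossing.
have h1 : b.2 - a.2 != 0 by rewrite subr_eq0 eq_sym.
have h2 : a.2 - b.2 != 0 by rewrite subr_eq0.
by field; apply/andP.
Qed.

Lemma crossing_lerp a b (t : R) : a.2 != b.2 ->
  let y := (1 - t) * a.2 + t * b.2 in
  (crossing a b y, y) = (1 - t) *: a + t *: b.
Proof.
move=> ab y; apply: plane_eq; rewrite !coordE //= /crossing /y.
have h1 : b.2 - a.2 != 0 by rewrite subr_eq0 eq_sym.
have -> : (1 - t) * a.2 + t * b.2 - a.2 = t * (b.2 - a.2) by ring.
by rewrite mulfK//; ring.
Qed.

Lemma cts_crossing a b f : continuous f ->
  continuous (fun y : R => f (crossing a b y, y)).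
Proof.
move=> cf y; apply: (@continuous_comp _ _ _ (fun y => (crossing a b y, y)) f);
  last exact: cf.
apply: (@cvg_pair _ _ _ (nbhs y) (nbhs (crossing a b y)) (nbhs y)); last exact: cvg_id.
apply: cvgD; first exact: cvg_cst.
apply: cvgMr_tmp; apply: cvgMr_tmp; apply: cvgB; [exact: cvg_id|exact: cvg_cst].
Qed.

(** Substitute [y = (1 - t) * a.2 + t * b.2]. *)
Lemma crossed_up a b f : continuous f -> a.2 < b.2 ->
  (leb R).-integrable setT (EFin \o crossed a b f) /\
  Rintegral (leb R) setT (crossed a b f) = (b.2 - a.2) * lint a b f.
Proof.
move=> cf ab; pose h y := f (crossing a b y, y).
have ch : continuous h by exact: cts_crossing.
have E : crossed a b f = h \_ `]a.2, b.2[.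
  apply/funext => y; rewrite /crossed patchE mem_setE in_itv /=.
  case: ifP => // _; case: ifP => //= /andP[h1 h2].
  by have := lt_trans h1 h2; rewrite ltNge ltW.
have io : (leb R).-integrable `]a.2, b.2[ (EFin \o h).
  apply: integrableS (integrable_itv a.2 b.2 ch) => //.
  exact: subset_itv_oo_cc.
rewrite E; split.
  rewrite -restrict_EFin; apply/(integrable_mkcond _ _).1 => //.
rewrite -Rintegral_mkcond Rintegral_itv_bndo_bndc//.
rewrite Rintegral_itv_obnd_cbnd; last first.
  by apply: integrableS (integrable_itv a.2 b.2 ch) => //; exact: subset_itv_oc_cc.
rewrite Rintegral_rescale//; congr (_ * _).
apply: eq_Rintegral => t _; rewrite /h; congr f.
by apply: crossing_lerp; rewrite lt_eqF.
Qed.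

Lemma crossed_integral a b f : continuous f ->
  (leb R).-integrable setT (EFin \o crossed a b f) /\
  Rintegral (leb R) setT (crossed a b f) = (b.2 - a.2) * lint a b f.
Proof.
move=> cf; have [ab|ba|ab] := ltgtP a.2 b.2; first exact: crossed_up.
- have [i e] := crossed_up cf ba.
  have E : crossed a b f = fun y => - 1 * crossed b a f y.
    apply/funext => y; rewrite /crossed crossingC ?gt_eqF//.
    case: ifP => [/andP[h1 h2]|_].
      by have := lt_trans (lt_trans h1 h2) ba; rewrite ltxx.
    case: ifP => _; first by rewrite mulN1r.
    by rewrite mulr0.
  rewrite E; split; last by rewrite RintegralZl// e (lintC a b cf); ring.
  have -> : EFin \o (fun y => - 1 * crossed b a f y) =
    (fun y => (- 1)%:E * (EFin \o crossed b a f) y)%E by [].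
  exact: integrableZl.
- have -> : crossed a b f = fun=> 0.
    apply/funext => y; rewrite /crossed ab.
    suff -> : (b.2 < y < b.2) = false by [].
    by apply/negbTE/negP => /andP[h1 h2]; have := lt_trans h1 h2; rewrite ltxx.
  rewrite ab subrr mul0r /Rintegral; split; last by rewrite integral0.
  exact: integrable0.
Qed.

End Green.

(** * Horizontal slices of a triangle *)

Section GreenTriangle.
Context (R : realType).
Implicit Types (f g : R * R -> R) (a b c x : R * R).

Definition C1 f : Prop :=
  [/\ forall x, differentiable f x, continuous ('D_(1, 0) f) &
      continuous ('D_(0, 1) f)].

Lemma C1_cts f : C1 f -> continuous f.
Proof. by case=> df _ _ x; exact: differentiable_continuous. Qed.

Lemma is_derive_row f (x y : R) : (forall z, differentiable f z) ->
  is_derive x 1 (fun t => f (t, y)) ('D_(1, 0) f (x, y)).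
Proof.
move=> df; have D : derivable f (x, y) (1, 0) by exact: diff_derivable.
have E : (fun h : R => h^-1 *: (f (h *: 1 + x, y) - f (x, y))) =
         (fun h : R => h^-1 *: (f (h *: (1, 0) + (x, y)) - f (x, y))).
  apply/funext => h; congr (_ *: (f _ - _)).
  by apply: plane_eq; rewrite !coordE //= mulr0 add0r.
apply: DeriveDef; rewrite /derivable /derive /shift /= /comp /=.
  by rewrite E.
by rewrite E.
Qed.

Lemma Rintegral_conv (F g : R -> R) (u w : R) : continuous g ->
  (forall x : R, is_derive x 1 F (g x)) ->
  Rintegral (leb R) [set x | exists2 s, 0 <= s <= 1 & x = (1 - s) * u + s * w] g =
  Num.sg (w - u) * (F w - F u).
Proof.
move=> cg dF.
wlog uw : u w / u <= w.
  move=> H; case: (leP u w) => [|/ltW wu]; first exact: H.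
  have -> : [set x | exists2 s, 0 <= s <= 1 & x = (1 - s) * u + s * w] =
            [set x | exists2 s, 0 <= s <= 1 & x = (1 - s) * w + s * u].
    apply/seteqP; split => x [s s01 ->]; exists (1 - s); try ring;
    by move: s01 => /andP[s0 s1]; apply/andP; split; lra.
  by rewrite H// -opprB sgrN; ring.
have -> : [set x | exists2 s, 0 <= s <= 1 & x = (1 - s) * u + s * w] = `[u, w]%classic.
  apply/seteqP; split => x /=; rewrite in_itv /=.
    by move=> [s /andP[s0 s1] ->]; apply/andP; split; nra.
  move=> /andP[ux xw]; move: uw; rewrite le_eqVlt => /predU1P[uw|uw].
    exists 0; first by rewrite lexx ler01.
    by have -> : x = u by [lra]; ring.
  exists ((x - u) / (w - u)); last by field; rewrite subr_eq0 gt_eqF.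
  apply/andP; split; first by apply: divr_ge0; lra.
  by rewrite ler_pdivrMr; lra.
rewrite (FTC2_le cg dF uw); move: uw; rewrite le_eqVlt => /predU1P[->|uw].
  by rewrite !subrr mulr0.
by rewrite gtr0_sg ?mul1r// subr_gt0.
Qed.

Definition row_slice (A : set (R * R)) (y : R) : set R := [set x | A (x, y)].

Lemma frac01 (p q : R) : 0 < p * (q - p) -> 0 < p / q < 1.
Proof.
have pos (p' q' : R) : 0 < p' -> p' < q' -> 0 < p' / q' < 1.
  move=> p0 pq; have q0 : 0 < q' := lt_trans p0 pq.
  by rewrite divr_gt0//= ltr_pdivrMr// mul1r.
have [p0|p0|->] := ltgtP p 0; last by rewrite mul0r ltxx.
  rewrite nmulr_rgt0// subr_lt0 => qp.
  by rewrite -mulrNN -invrN; apply: pos; lra.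
by rewrite pmulr_rgt0// subr_gt0 => qp; exact: pos.
Qed.

(** The horizontal line separates [a] from [b] and [c], so it crosses the sides at
[a]; the slice is the segment between the two crossing points. *)
Lemma slice_odd a b c (y : R) : 0 < (y - a.2) * (b.2 - y) ->
  0 < (y - a.2) * (c.2 - y) ->
  row_slice (triangle a b c) y =
  [set x | exists2 s, 0 <= s <= 1 &
     x = (1 - s) * crossing a c y + s * crossing a b y].
Proof.
move=> hb hc.
have nz (q : R) : 0 < (y - a.2) * (q - y) -> q - a.2 != 0.
  move=> h; apply/eqP => e; have qE : q = a.2 by lra.
  have : 0 <= (y - a.2) ^+ 2 by exact: sqr_ge0.
  by move: h; rewrite qE (_ : _ * _ = - (y - a.2) ^+ 2); [lra|ring].
have lerp (q : R) : 0 < (y - a.2) * (q - y) -> 0 < (y - a.2) / (q - a.2) < 1.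
  by move=> h; apply: frac01; rewrite (_ : _ - (y - a.2) = q - y) //; ring.
rewrite /crossing; move: (nz _ hb) (nz _ hc) (lerp _ hb) (lerp _ hc).
have yE : y - a.2 != 0 by apply/eqP => e; move: hb; rewrite e mul0r ltxx.
move=> b0 c0.
set s := (_ / _); set r := (_ / (c.2 - _)) => /andP[s0 s1] /andP[r0 r1].
have sE : s * (b.2 - a.2) = y - a.2 by rewrite divfK.
have rE : r * (c.2 - a.2) = y - a.2 by rewrite divfK.
apply/seteqP; split => x.
  move=> [al [be [ga [al0 be0 ga0 e xyE]]]].
  have xE : x = al * a.1 + be * b.1 + ga * c.1 by have := congr1 fst xyE.
  have yy : y = al * a.2 + be * b.2 + ga * c.2 by have := congr1 snd xyE.
  have e1 : be / s + ga / r = 1.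
    have -> : be / s = be * (b.2 - a.2) / (y - a.2).
      by rewrite -sE; field; rewrite b0 gt_eqF.
    have -> : ga / r = ga * (c.2 - a.2) / (y - a.2).
      by rewrite -rE; field; rewrite c0 gt_eqF.
    have e2 : (al + be + ga) * a.2 = a.2 by rewrite e mul1r.
    rewrite -mulrDl (_ : be * (b.2 - a.2) + _ = y - a.2); last by lra.
    exact: divff.
  have h1 : 0 <= be / s by apply: divr_ge0 => //; exact: ltW.
  have h2 : 0 <= ga / r by apply: divr_ge0 => //; exact: ltW.
  have [B [B01 beE gaE]] : exists B, [/\ 0 <= B <= 1, be = B * s & ga = (1 - B) * r].
    exists (be / s); split; first by lra.
      by rewrite divfK// gt_eqF.
    by rewrite (_ : 1 - _ = ga / r) ?divfK ?gt_eqF//; lra.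
  (* [be / s] and [ga / r] are the weights of the crossing points on the sides *)
  (* [a b] and [a c] *)
  exists B => //; rewrite xE (_ : al = 1 - be - ga); last by lra.
  by rewrite beE gaE; ring.
move=> [th /andP[th0 th1] ->].
exists (1 - th * s - (1 - th) * r), (th * s), ((1 - th) * r).
have -> : y = a.2 + (th * (s * (b.2 - a.2)) + (1 - th) * (r * (c.2 - a.2))).
  by rewrite sE rE; ring.
split; [nra|nra|nra|ring|].
by apply: plane_eq; rewrite !coordE /=; ring.
Qed.

Lemma crossing_gap a b c (y : R) : b.2 - a.2 != 0 -> c.2 - a.2 != 0 ->
  crossing a b y - crossing a c y =
  (y - a.2) * det a b c / ((b.2 - a.2) * (c.2 - a.2)).
Proof. by move=> b0 c0; rewrite /crossing /det; field; apply/andP. Qed.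

Lemma crossed_pos a b f (y : R) : a.2 < y -> y < b.2 ->
  crossed a b f y = f (crossing a b y, y).
Proof. by rewrite /crossed => -> ->. Qed.

Lemma crossed_neg a b f (y : R) : b.2 < y -> y < a.2 ->
  crossed a b f y = - f (crossing a b y, y).
Proof. by rewrite /crossed => h1 h2; rewrite h1 h2 (lt_gtF h2). Qed.

Lemma crossed_above a b f (y : R) : a.2 < y -> b.2 < y ->
  crossed a b f y = 0.
Proof. by rewrite /crossed => h1 h2; rewrite (lt_gtF h1) (lt_gtF h2) !andbF. Qed.

Lemma crossed_below a b f (y : R) : y < a.2 -> y < b.2 ->
  crossed a b f y = 0.
Proof. by rewrite /crossed => h1 h2; rewrite (lt_gtF h1) (lt_gtF h2). Qed.

(** The fundamental theorem of calculus leaves the values at the two crossing points.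
Which of them is on the right is decided by the orientation of the triangle and
by the side of [a] on which the line passes, and [crossed] carries the same
signs. *)
Lemma slice_integral_odd a b c f (y : R) : C1 f ->
  0 < (y - a.2) * (b.2 - y) -> 0 < (y - a.2) * (c.2 - y) ->
  Rintegral (leb R) (row_slice (triangle a b c) y)
    (fun x : R => 'D_(1, 0) f (x, y)) =
  Num.sg (det a b c) * (crossed a b f y + crossed b c f y + crossed c a f y).
Proof.
move=> Cf hb hc; have [df cD _] := Cf.
have cg : continuous (fun x : R => 'D_(1, 0) f (x, y)).
  move=> x; apply: (@continuous_comp _ _ _ (fun t => (t, y)) ('D_(1, 0) f)).
    by apply: (@cvg_pair _ _ _ (nbhs x) (nbhs x) (nbhs y)); [exact: cvg_id|exact: cvg_cst].
  exact: cD.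
rewrite slice_odd// (Rintegral_conv _ _ cg (fun x : R => is_derive_row x y df)).
have nz (q : R) : 0 < (y - a.2) * (q - y) -> q - a.2 != 0.
  move=> h; apply/eqP => e; have qE : q = a.2 by lra.
  have : 0 <= (y - a.2) ^+ 2 by exact: sqr_ge0.
  by move: h; rewrite qE (_ : _ * _ = - (y - a.2) ^+ 2); [lra|ring].
have b0 := nz _ hb; have c0 := nz _ hc.
rewrite crossing_gap//.
rewrite [crossing a c y]crossingC; last by rewrite eq_sym -subr_eq0.
have ya : y != a.2 by apply/eqP => e; move: hb; rewrite e subrr mul0r ltxx.
case: (ltP y a.2) => [{}ya|]; last rewrite le_eqVlt eq_sym (negbTE ya) /= => {}ya.
- have yb : b.2 < y by nra.
  have yc : c.2 < y by nra.
  rewrite crossed_neg// crossed_above// crossed_pos//.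
  rewrite sgrM sgrV sgrM (@ltr0_sg _ (y - a.2)) ?subr_lt0//.
  rewrite sgrM (@ltr0_sg _ (b.2 - a.2)) ?subr_lt0 ?(lt_trans yb)//.
  by rewrite (@ltr0_sg _ (c.2 - a.2)) ?subr_lt0 ?(lt_trans yc)//; ring.
- have yb : y < b.2 by nra.
  have yc : y < c.2 by nra.
  rewrite crossed_pos// crossed_below// crossed_neg//.
  rewrite sgrM sgrV sgrM (@gtr0_sg _ (y - a.2)) ?subr_gt0//.
  rewrite sgrM (@gtr0_sg _ (b.2 - a.2)) ?subr_gt0 ?(lt_trans ya)//.
  by rewrite (@gtr0_sg _ (c.2 - a.2)) ?subr_gt0 ?(lt_trans ya)//; ring.
Qed.

(** The sign [s] treats together the lines above and the lines below the triangle. *)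
Lemma row_slice0 a b c (y s : R) : 0 < s * (y - a.2) ->
  0 < s * (y - b.2) -> 0 < s * (y - c.2) -> row_slice (triangle a b c) y = set0.
Proof.
move=> ha hb hc; apply/seteqP; split => x //= [al [be [ga [al0 be0 ga0 e xyE]]]].
have yE : y = al * a.2 + be * b.2 + ga * c.2 by have := congr1 snd xyE.
have h1 := mulr_ge0 al0 (ltW ha).
have h2 := mulr_ge0 be0 (ltW hb).
have h3 := mulr_ge0 ga0 (ltW hc).
have h : al * (s * (y - a.2)) + be * (s * (y - b.2)) + ga * (s * (y - c.2)) = 0.
  transitivity (s * ((al + be + ga) * y - (al * a.2 + be * b.2 + ga * c.2))).
    by ring.
  by rewrite e -yE mul1r subrr mulr0.
have z (u v : R) : 0 <= u -> 0 < v -> u * v <= 0 -> u = 0.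
  by move=> u0 v0; rewrite pmulr_lle0// => u1; apply/eqP; rewrite eq_le u0 u1.
have := z _ _ al0 ha ltac:(lra); have := z _ _ be0 hb ltac:(lra).
have := z _ _ ga0 hc ltac:(lra); lra.
Qed.

(** Off the heights of the three vertices, a horizontal line either misses the
triangle or separates one vertex from the two others, and both sides of the
equation are invariant under cyclic permutations of the vertices. *)
Lemma slice_integral a b c f (y : R) : C1 f ->
  y != a.2 -> y != b.2 -> y != c.2 -> det a b c != 0 ->
  Rintegral (leb R) (row_slice (triangle a b c) y)
    (fun x : R => 'D_(1, 0) f (x, y)) =
  Num.sg (det a b c) * (crossed a b f y + crossed b c f y + crossed c a f y).
Proof.
move=> Cf ya yb yc d0.
have up (u v : R) : u < y -> y < v -> 0 < (y - u) * (v - y).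
  by move=> uy yv; rewrite mulr_gt0// subr_gt0.
have dn (u v : R) : y < u -> v < y -> 0 < (y - u) * (v - y).
  by move=> uy yv; rewrite nmulr_rgt0 subr_lt0.
have [hb hc] : (triangle b c a = triangle a b c) /\ (triangle c a b = triangle a b c).
  by split; [|rewrite (triangle_cycle b)]; rewrite (triangle_cycle a).
have B : 0 < (y - b.2) * (c.2 - y) -> 0 < (y - b.2) * (a.2 - y) ->
    Rintegral (leb R) (row_slice (triangle a b c) y)
      (fun x : R => 'D_(1, 0) f (x, y)) =
    Num.sg (det a b c) * (crossed a b f y + crossed b c f y + crossed c a f y).
  move=> h1 h2; rewrite -hb (slice_integral_odd Cf h1 h2) (det_cycle a).
  by rewrite addrC addrA.
have C : 0 < (y - c.2) * (a.2 - y) -> 0 < (y - c.2) * (b.2 - y) ->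
    Rintegral (leb R) (row_slice (triangle a b c) y)
      (fun x : R => 'D_(1, 0) f (x, y)) =
    Num.sg (det a b c) * (crossed a b f y + crossed b c f y + crossed c a f y).
  move=> h1 h2; rewrite -hc (slice_integral_odd Cf h1 h2) (det_cycle b) (det_cycle a).
  by rewrite -addrA addrC.
move: ya yb yc; rewrite !neq_lt => /orP[ya|ya] /orP[yb|yb] /orP[yc|yc];
  try by [apply: slice_integral_odd => //; [exact: up|exact: up]
         |apply: slice_integral_odd => //; [exact: dn|exact: dn]
         |apply: B; [exact: up|exact: up]|apply: B; [exact: dn|exact: dn]
         |apply: C; [exact: up|exact: up]|apply: C; [exact: dn|exact: dn]].
- rewrite (@row_slice0 _ _ _ _ (- 1)) ?mulN1r ?oppr_gt0 ?subr_lt0//.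
  rewrite Rintegral_set0 !crossed_below//; ring.
- rewrite (@row_slice0 _ _ _ _ 1) ?mul1r ?subr_gt0//.
  rewrite Rintegral_set0 !crossed_above//; ring.
Qed.

End GreenTriangle.

(** * Green's formulas on a triangle *)

Section GreenFormula.
Context (R : realType).
Implicit Types (f g : R * R -> R) (a b c x : R * R).

Lemma Rintegral_rows (A : set (R * R)) f (k : R -> R) (S : set R) :
  measurable (A : set (plane R)) ->
  (@mu2 R).-integrable (A : set (plane R)) (EFin \o f) ->
  (leb R).-integrable setT (EFin \o k) -> countable S ->
  (forall y : R, ~ S y ->
    Rintegral (leb R) (row_slice A y) (fun x : R => f (x, y)) = k y) ->
  Rintegral (@mu2 R) A f = Rintegral (leb R) setT k.
Proof.
move=> mA iA ik cS hk.
have iA' : (@mu2 R).-integrable setT ((EFin \o f) \_ (A : set (plane R))).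
  exact/(integrable_mkcond _ _).1.
rewrite /Rintegral integral_mkcond -integral21_prod_meas1//; congr fine.
apply: ae_eq_integral.
- by [].
- exact: (measurable_fubini_G iA').
- exact: measurable_int ik.
have Sae : {ae leb R, forall y, ~ S y}.
  exists S; split; last by move=> y /= /contrapT.
    by apply: countable_measurable => // t; exact: measurable_set1.
  exact: countable_lebesgue_measure0.
apply: (@filterS2 _ _ (ae_filter_ringOfSetsType (leb R)) _ _ _ _ Sae (ae_integrable2 iA')).
move=> y /hk {}hk iy _ /=.
rewrite -hk /fubini_G /Rintegral.
have E : (\int[leb R]_x ((EFin \o f) \_ (A : set (plane R))) (x, y) =
  \int[leb R]_(x in row_slice A y) (f (x, y))%:E)%E.
  rewrite [RHS]integral_mkcond; apply: eq_integral => x _.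
  by rewrite !patchE; congr (if _ then _ else _); apply/idP/idP; rewrite !inE.
by rewrite -E fineK//; exact: integrable_fin_num.
Qed.

(** By Fubini the integral is that of its horizontal slices, and [slice_integral]
turns almost every slice into boundary values. *)
Lemma green1 a b c f : C1 f -> det a b c != 0 ->
  Rintegral (@mu2 R) (triangle a b c) ('D_(1, 0) f) =
  Num.sg (det a b c) * ((b.2 - a.2) * lint a b f + (c.2 - b.2) * lint b c f +
                        (a.2 - c.2) * lint c a f).
Proof.
move=> Cf d0; have [df c1 _] := Cf.
have cf := C1_cts Cf.
have [i1 e1] := crossed_integral a b cf.
have [i2 e2] := crossed_integral b c cf.
have [i3 e3] := crossed_integral c a cf.
have i12 : (leb R).-integrable setT (EFin \o (fun y => crossed a b f y + crossed b c f y)).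
  exact: integrableD i1 i2.
have i123 : (leb R).-integrable setT
    (EFin \o (fun y => crossed a b f y + crossed b c f y + crossed c a f y)).
  exact: integrableD i12 i3.
have iS := integrableZl measurableT (Num.sg (det a b c)) i123.
rewrite -e1 -e2 -e3 -RintegralD// -RintegralD// -RintegralZl//.
apply: (@Rintegral_rows _ _ _ [set a.2; b.2; c.2]) => //.
- exact: measurable_triangle.
- exact: integrable_triangle.
- by apply: finite_set_countable.
- move=> y ny; apply: slice_integral => //; apply/eqP => E; apply: ny; rewrite E /=.
  + by left; left.
  + by left; right.
  + by right.
Qed.

Lemma differentiable_fst x : differentiable (fst : R * R -> R) x.
Proof. by apply: linear_differentiable => y; exact: cvg_fst. Qed.

Lemma differentiable_snd x : differentiable (snd : R * R -> R) x.
Proof. by apply: linear_differentiable => y; exact: cvg_snd. Qed.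

Definition swap x : R * R := (x.2, x.1).

Lemma cts_swap : continuous swap.
Proof.
move=> x; apply: (@cvg_pair _ _ _ (nbhs x) (nbhs x.2) (nbhs x.1)).
  exact: cvg_snd.
exact: cvg_fst.
Qed.

Lemma derive_swap f (u v : R) x :
  'D_(u, v) (f \o swap) x = 'D_(v, u) f (swap x).
Proof.
rewrite /derive; congr (lim (_ @ _)); apply/funext => h.
Qed.

Lemma C1_swap f : C1 f -> C1 (f \o swap).
Proof.
move=> [df c1 c2]; split.
- move=> x; apply: differentiable_comp; last exact: df.
  by apply: differentiable_pair; [exact: differentiable_snd|exact: differentiable_fst].
- have -> : 'D_(1, 0) (f \o swap) = 'D_(0, 1) f \o swap by apply/funext => x; rewrite derive_swap.
  by move=> x; apply: continuous_comp; [exact: cts_swap|exact: c2].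
- have -> : 'D_(0, 1) (f \o swap) = 'D_(1, 0) f \o swap by apply/funext => x; rewrite derive_swap.
  by move=> x; apply: continuous_comp; [exact: cts_swap|exact: c1].
Qed.

Lemma Rintegral_swap (A B : set (R * R)) f g :
  (forall x, B x <-> A (swap x)) -> (forall x, g x = f (swap x)) ->
  measurable (A : set (plane R)) -> measurable (B : set (plane R)) ->
  (@mu2 R).-integrable (A : set (plane R)) (EFin \o f) ->
  (@mu2 R).-integrable (B : set (plane R)) (EFin \o g) ->
  Rintegral (@mu2 R) A f = Rintegral (@mu2 R) B g.
Proof.
move=> BA gf mA mB iA iB.
have iA' : (@mu2 R).-integrable setT ((EFin \o f) \_ (A : set (plane R))).
  exact/(integrable_mkcond _ _).1.
have iB' : (@mu2 R).-integrable setT ((EFin \o g) \_ (B : set (plane R))).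
  exact/(integrable_mkcond _ _).1.
rewrite /Rintegral integral_mkcond [in RHS]integral_mkcond; congr fine.
rewrite -(integral12_prod_meas1 iA') -(integral21_prod_meas1 iB').
apply: eq_integral => x _; apply: eq_integral => y _.
rewrite !patchE /= gf; congr (if _ then _ else _).
by apply/idP/idP; rewrite !inE; [apply: (BA (y, x)).2|apply: (BA (y, x)).1].
Qed.

Lemma swap_triangle a b c x :
  triangle (swap a) (swap b) (swap c) x <-> triangle a b c (swap x).
Proof.
split=> -[r [s [t [r0 s0 t0 e xE]]]]; exists r, s, t; split => //.
  by rewrite xE.
by apply: plane_eq; [exact: (congr1 snd xE)|exact: (congr1 fst xE)].
Qed.

(** Exchanging the coordinates reduces this to [green1] and reverses the orientation. *)
Lemma green2 a b c f : C1 f -> det a b c != 0 ->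
  Rintegral (@mu2 R) (triangle a b c) ('D_(0, 1) f) =
  - Num.sg (det a b c) * ((b.1 - a.1) * lint a b f + (c.1 - b.1) * lint b c f +
                          (a.1 - c.1) * lint c a f).
Proof.
move=> Cf d0.
have dE : det (swap a) (swap b) (swap c) = - det a b c by rewrite /det /=; ring.
have d1 : det (swap a) (swap b) (swap c) != 0 by rewrite dE oppr_eq0.
have [_ c1 c2] := Cf; have [_ c1' _] := C1_swap Cf.
have := green1 (C1_swap Cf) d1; rewrite dE sgrN => <-.
apply: Rintegral_swap.
- exact: swap_triangle.
- by move=> x; rewrite derive_swap.
- exact: measurable_triangle.
- exact: measurable_triangle.
- exact: integrable_triangle.
- exact: integrable_triangle.
Qed.

End GreenFormula.

(** * Continuously differentiable functions and polynomials *)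

Section Calculus.
Context (R : realType).
Implicit Types (f g : R * R -> R) (a b c x u : R * R).

Lemma C1_add f g : C1 f -> C1 g ->
  [/\ C1 (fun x => f x + g x),
      'D_(1, 0) (fun x => f x + g x) = (fun x => 'D_(1, 0) f x + 'D_(1, 0) g x) &
      'D_(0, 1) (fun x => f x + g x) = (fun x => 'D_(0, 1) f x + 'D_(0, 1) g x)].
Proof.
move=> [df f1 f2] [dg g1 g2].
have E u : 'D_u (fun x => f x + g x) = (fun x => 'D_u f x + 'D_u g x).
  by apply/funext => x; rewrite deriveD//; exact: diff_derivable.
split; [|exact: E|exact: E]; split; rewrite ?E => x.
- exact: differentiableD.
- by apply: cvgD; [exact: f1|exact: g1].
- by apply: cvgD; [exact: f2|exact: g2].
Qed.

Lemma C1_mul f g : C1 f -> C1 g ->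
  [/\ C1 (fun x => f x * g x),
      'D_(1, 0) (fun x => f x * g x) =
        (fun x => f x * 'D_(1, 0) g x + g x * 'D_(1, 0) f x) &
      'D_(0, 1) (fun x => f x * g x) =
        (fun x => f x * 'D_(0, 1) g x + g x * 'D_(0, 1) f x)].
Proof.
move=> Cf Cg; have cf := C1_cts Cf; have cg := C1_cts Cg.
have [df f1 f2] := Cf; have [dg g1 g2] := Cg.
have E u : 'D_u (fun x => f x * g x) = (fun x => f x * 'D_u g x + g x * 'D_u f x).
  by apply/funext => x; rewrite deriveM//; exact: diff_derivable.
split; [|exact: E|exact: E]; split; rewrite ?E => x.
- exact: differentiableM.
- by apply: cvgD; apply: cvgM; [exact: cf|exact: g1|exact: cg|exact: f1].
- by apply: cvgD; apply: cvgM; [exact: cf|exact: g2|exact: cg|exact: f2].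
Qed.

Lemma C1_cst (k : R) : C1 (fun _ : R * R => k).
Proof.
have E u : 'D_u (fun _ : R * R => k) = cst 0.
  by apply/funext => x; rewrite derive_cst.
by split => [x||]; rewrite ?E; [exact: differentiable_cst|exact: cst_continuous..].
Qed.

Lemma derive_linear (l : {linear (R * R)%type -> R}) u : continuous l ->
  'D_u l = cst (l u).
Proof.
move=> cl; apply/funext => x; rewrite deriveE ?diff_lin//.
exact: linear_differentiable.
Qed.

Lemma C1_fst : C1 (fst : R * R -> R).
Proof.
have c : continuous (fst : R * R -> R) by move=> ?; exact: cvg_fst.
by split => [x||]; rewrite ?derive_linear//; [exact: differentiable_fst|exact: cst_continuous..].
Qed.

Lemma C1_snd : C1 (snd : R * R -> R).
Proof.
have c : continuous (snd : R * R -> R) by move=> ?; exact: cvg_snd.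
by split => [x||]; rewrite ?derive_linear//; [exact: differentiable_snd|exact: cst_continuous..].
Qed.

Lemma C1_exp f n : C1 f ->
  [/\ C1 (fun x => f x ^+ n),
      'D_(1, 0) (fun x => f x ^+ n) =
        (fun x => n%:R * f x ^+ n.-1 * 'D_(1, 0) f x) &
      'D_(0, 1) (fun x => f x ^+ n) =
        (fun x => n%:R * f x ^+ n.-1 * 'D_(0, 1) f x)].
Proof.
move=> Cf; elim: n => [|n [IH e1 e2]].
  split; first exact: C1_cst.
    by apply/funext => x; rewrite derive_cst !mul0r.
  by apply/funext => x; rewrite derive_cst !mul0r.
have [h h1 h2] := C1_mul Cf IH.
have E : (fun x => f x ^+ n.+1) = (fun x => f x * f x ^+ n).
  by apply/funext => x; rewrite exprS.
have R0 (d : R) x : f x * (n%:R * f x ^+ n.-1 * d) + f x ^+ n * d =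
    n.+1%:R * f x ^+ n * d.
  rewrite -(natr1 n); case: (n) => [|m] /=; first by rewrite expr0; ring.
  by rewrite exprS; ring.
rewrite E; split; first exact: h.
  rewrite h1; apply/funext => x; rewrite -R0; congr (f x * _ + _).
  exact: (congr1 (@^~ x) e1).
rewrite h2; apply/funext => x; rewrite -R0; congr (f x * _ + _).
exact: (congr1 (@^~ x) e2).
Qed.

Definition mono (c : R) (i j : nat) x : R := c * x.1 ^+ i * x.2 ^+ j.

Lemma C1_mono (c : R) i j :
  [/\ C1 (mono c i j),
      'D_(1, 0) (mono c i j) = mono (c * i%:R) i.-1 j &
      'D_(0, 1) (mono c i j) = mono (c * j%:R) i j.-1].
Proof.
have [h1 e1 e1'] := C1_exp i C1_fst.
have [h2 e2 e2'] := C1_mul (C1_cst c) h1.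
have [h3 e3 e3'] := C1_exp j C1_snd.
have [h4 e4 e4'] := C1_mul h2 h3.
have cf : continuous (fst : R * R -> R) by move=> ?; exact: cvg_fst.
have cs : continuous (snd : R * R -> R) by move=> ?; exact: cvg_snd.
have at_pt u x : 'D_u (fun y : R * R => c * y.1 ^+ i * y.2 ^+ j) x =
    c * x.1 ^+ i * 'D_u (fun y : R * R => y.2 ^+ j) x +
    x.2 ^+ j * 'D_u (fun y : R * R => c * y.1 ^+ i) x ->
  'D_u (fun y : R * R => c * y.1 ^+ i) x =
    c * 'D_u (fun y : R * R => y.1 ^+ i) x + x.1 ^+ i * 'D_u (cst c : R * R -> R) x ->
  'D_u (fun y : R * R => y.1 ^+ i) x = i%:R * x.1 ^+ i.-1 * 'D_u (fst : R * R -> R) x ->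
  'D_u (fun y : R * R => y.2 ^+ j) x = j%:R * x.2 ^+ j.-1 * 'D_u (snd : R * R -> R) x ->
  'D_u (mono c i j) x = c * x.1 ^+ i * (j%:R * x.2 ^+ j.-1 * u.2) +
    x.2 ^+ j * (c * (i%:R * x.1 ^+ i.-1 * u.1)).
  move=> E4 E2 E1 E3; apply: (etrans E4); rewrite E2 E1 E3.
  have -> : 'D_u (cst c : R * R -> R) x = 0 by exact: derive_cst.
  have -> : 'D_u (fst : R * R -> R) x = u.1 by exact: (congr1 (@^~ x) (@derive_linear fst u cf)).
  have -> : 'D_u (snd : R * R -> R) x = u.2 by exact: (congr1 (@^~ x) (@derive_linear snd u cs)).
  by rewrite mulr0 addr0.
split; [exact: h4|apply/funext => x..].
  rewrite at_pt /=; [by rewrite /mono; ring|exact: (congr1 (@^~ x) e4)|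
    exact: (congr1 (@^~ x) e2)|exact: (congr1 (@^~ x) e1)|exact: (congr1 (@^~ x) e3)].
rewrite at_pt /=; [by rewrite /mono; ring|exact: (congr1 (@^~ x) e4')|
  exact: (congr1 (@^~ x) e2')|exact: (congr1 (@^~ x) e1')|exact: (congr1 (@^~ x) e3')].
Qed.

(** Every polynomial is a sum of monomials, so a property of functions stable
under sums is checked on monomials. *)
Lemma is_poly_ind (P : (R * R -> R) -> Prop) k :
  P (fun=> 0) -> (forall f g, P f -> P g -> P (fun x => f x + g x)) ->
  (forall (c : R) i j, (i + j <= k)%N -> P (mono c i j)) ->
  forall f, is_poly k f -> P f.
Proof.
move=> P0 PD Pm f [c fE].
have -> : f = \sum_(i < k.+1) \sum_(j < k.+1 | (i + j <= k)%N) mono (c i j) i j.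
  apply/funext => x; rewrite fE fct_sumE; apply: eq_bigr => i _.
  by rewrite fct_sumE.
apply: big_ind => // i _; apply: big_ind => // j ij.
exact: Pm.
Qed.

Lemma is_poly0 k : is_poly k (fun _ : R * R => 0).
Proof.
exists (fun _ _ => 0) => x; rewrite big1// => i _; rewrite big1// => j _.
by rewrite !mul0r.
Qed.

Lemma is_poly_add k f g : is_poly k f -> is_poly k g ->
  is_poly k (fun x => f x + g x).
Proof.
move=> [c fE] [d gE]; exists (fun i j => c i j + d i j) => x.
rewrite fE gE -big_split/=; apply: eq_bigr => i _.
by rewrite -big_split/=; apply: eq_bigr => j _; rewrite !mulrDl.
Qed.

Lemma is_poly_scale k (a : R) f : is_poly k f -> is_poly k (fun x => a * f x).
Proof.
move=> [c fE]; exists (fun i j => a * c i j) => x.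
rewrite fE mulr_sumr; apply: eq_bigr => i _.
by rewrite mulr_sumr; apply: eq_bigr => j _; rewrite !mulrA.
Qed.

Lemma is_poly_mono k (c : R) i j : (i + j <= k)%N -> is_poly k (mono c i j).
Proof.
move=> ij; exists (fun i' j' => if (i' == i) && (j' == j) then c else 0) => x.
have ik : (i < k.+1)%N by rewrite ltnS (leq_trans _ ij)// leq_addr.
have jk : (j < k.+1)%N by rewrite ltnS (leq_trans _ ij)// leq_addl.
rewrite (bigD1 (Ordinal ik))//= [X in _ + X]big1 ?addr0; last first.
  move=> i' ne; rewrite big1// => j' _; rewrite ifN ?mul0r//.
  by apply: contra ne => /andP[/eqP e _]; exact/eqP/val_inj.
rewrite (bigD1 (Ordinal jk))//= [X in _ + X]big1 ?addr0.
  by rewrite !eqxx.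
move=> j' /andP[_ ne]; rewrite ifN ?mul0r//.
by apply: contra ne => /andP[_ /eqP e]; exact/eqP/val_inj.
Qed.

Lemma is_poly_cst k (c : R) : is_poly k (fun _ : R * R => c).
Proof.
rewrite (_ : (fun _ => _) = mono c 0 0); first exact: is_poly_mono.
by apply/funext => x; rewrite /mono !expr0 !mulr1.
Qed.

Lemma is_poly_C1 k f : is_poly k f -> C1 f.
Proof.
move: f; apply: is_poly_ind; first exact: C1_cst.
  by move=> f g Cf Cg; have [] := C1_add Cf Cg.
by move=> c i j _; have [] := C1_mono c i j.
Qed.

Lemma affine_mono k (p q r c : R) i j : (i + j < k)%N ->
  is_poly k (fun x => (p * x.1 + q * x.2 + r) * mono c i j x).
Proof.
move=> ij.
have -> : (fun x => (p * x.1 + q * x.2 + r) * mono c i j x) =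
    (fun x => mono (p * c) i.+1 j x + mono (q * c) i j.+1 x + mono (r * c) i j x).
  by apply/funext => x; rewrite /mono !exprS; ring.
by apply: is_poly_add; [apply: is_poly_add|]; apply: is_poly_mono;
  rewrite ?addSn ?addnS// ltnW.
Qed.

(** Differentiation lowers the degree and an affine factor restores it. *)
Lemma affine_derive_poly k f (p q r : R) : is_poly k f ->
  C1 f /\ is_poly k (fun x => (p * x.1 + q * x.2 + r) * 'D_(1, 0) f x) /\
  is_poly k (fun x => (p * x.1 + q * x.2 + r) * 'D_(0, 1) f x).
Proof.
move: f; apply: is_poly_ind.
- split; first exact: C1_cst.
  by split; rewrite (_ : (fun x => _) = (fun=> 0)); try exact: is_poly0;
    apply/funext => x; rewrite derive_cst mulr0.
- move=> f g [Cf [f1 f2]] [Cg [g1 g2]]; have [h e1 e2] := C1_add Cf Cg.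
  split; [exact: h|split].
    rewrite (_ : (fun x => _) = (fun x => (p * x.1 + q * x.2 + r) * 'D_(1, 0) f x
      + (p * x.1 + q * x.2 + r) * 'D_(1, 0) g x)); first exact: is_poly_add.
    by apply/funext => x; rewrite -mulrDr; congr (_ * _); exact: (congr1 (@^~ x) e1).
  rewrite (_ : (fun x => _) = (fun x => (p * x.1 + q * x.2 + r) * 'D_(0, 1) f x
    + (p * x.1 + q * x.2 + r) * 'D_(0, 1) g x)); first exact: is_poly_add.
  by apply/funext => x; rewrite -mulrDr; congr (_ * _); exact: (congr1 (@^~ x) e2).
- have z (c d : R) i j : is_poly k (fun x => (p * x.1 + q * x.2 + r) * mono (c * 0) i j x).
    rewrite (_ : (fun x => _) = (fun=> 0)); first exact: is_poly0.
    by apply/funext => x; rewrite /mono; ring.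
  move=> c i j ij; have [h e1 e2] := C1_mono c i j; split; [exact: h|split].
    rewrite (_ : (fun x => _) = (fun x => (p * x.1 + q * x.2 + r) * mono (c * i%:R) i.-1 j x)).
      by case: i ij {h e1 e2} => [|i] ij /=; [exact: z|exact: affine_mono].
    by apply/funext => x; congr (_ * _); exact: (congr1 (@^~ x) e1).
  rewrite (_ : (fun x => _) = (fun x => (p * x.1 + q * x.2 + r) * mono (c * j%:R) i j.-1 x)).
    by case: j ij {h e1 e2} => [|j] ij /=; [exact: z|apply: affine_mono; rewrite -addnS].
  by apply/funext => x; congr (_ * _); exact: (congr1 (@^~ x) e2).
Qed.

End Calculus.

(** * The divergence theorem on a triangle *)

Section DivergenceTheorem.
Context (R : realType).
Implicit Types (f g : R * R -> R) (v : R * R -> R * R) (a b c x : R * R).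

(** Outward normal of the triangle [a b c] on its side [a b], with the length of
that side as its norm. *)
Definition nvec a b c : R * R :=
  Num.sg (det a b c) *: ((b - a).2, - (b - a).1).

Definition divg v x : R :=
  'D_(1, 0) (fun y => (v y).1) x + 'D_(0, 1) (fun y => (v y).2) x.

Definition C1v v := C1 (fun x => (v x).1) /\ C1 (fun x => (v x).2).

Lemma cts_divg v : C1v v -> continuous (divg v).
Proof.
move=> [[_ h1 _] [_ _ h2]] x; apply: cvgD; [exact: h1|exact: h2].
Qed.

Lemma cts_dot v (n : R * R) : C1v v -> continuous (fun x => dot (v x) n).
Proof.
move=> [h1 h2] x; apply: cvgD; apply: cvgMr_tmp;
  [exact: (C1_cts h1)|exact: (C1_cts h2)].
Qed.

Lemma cts_flux v (n : R * R) f : C1v v -> continuous f ->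
  continuous (fun x => dot (v x) n * f x).
Proof. by move=> Cv cf x; apply: cvgM; [exact: cts_dot|exact: cf]. Qed.

(** Divergence theorem for the field [f v]: [green1] applies to its first component
and [green2] to the second one. *)
Lemma triangle_parts v f a b c : C1v v -> C1 f -> det a b c != 0 ->
  Rintegral (@mu2 R) (triangle a b c) (fun x => dot (v x) (grad f x)) =
  - Rintegral (@mu2 R) (triangle a b c) (fun x => divg v x * f x) +
  (lint a b (fun x => dot (v x) (nvec a b c) * f x) +
   lint b c (fun x => dot (v x) (nvec b c a) * f x) +
   lint c a (fun x => dot (v x) (nvec c a b) * f x)).
Proof.
move=> Cv Cf d0; have [C1v C2v] := Cv.
have [F1 e1 _] := C1_mul C1v Cf; have [F2 _ e2] := C1_mul C2v Cf.
have cf := C1_cts Cf; have c1 := C1_cts C1v; have c2 := C1_cts C2v.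
have cF1 := C1_cts F1; have cF2 := C1_cts F2.
have [_ i1 _] := F1; have [_ _ i2] := F2.
have flux p q r : Num.sg (det p q r) = Num.sg (det a b c) ->
    lint p q (fun x => dot (v x) (nvec p q r) * f x) =
    Num.sg (det a b c) * ((q.2 - p.2) * lint p q (fun x => (v x).1 * f x) -
      (q.1 - p.1) * lint p q (fun x => (v x).2 * f x)).
  move=> dE; rewrite -mulNr -lintZ// -lintZ// -lintD; first last.
  - by move=> x; apply: cvgMl_tmp; exact: cF2.
  - by move=> x; apply: cvgMl_tmp; exact: cF1.
  rewrite -lintZ; last first.
    by move=> x; apply: cvgD; apply: cvgMl_tmp; [exact: cF1|exact: cF2].
  by apply: eq_lint => x _; rewrite /nvec dE /dot !coordE /=; ring.
rewrite !flux ?(det_cycle c) ?(det_cycle b) ?(det_cycle a)//.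
have cdf : continuous (fun x => divg v x * f x).
  by move=> x; apply: cvgM; [exact: cts_divg|exact: cf].
have cg : continuous (fun x => dot (v x) (grad f x)).
  have [_ g1 g2] := Cf.
  by move=> x; apply: cvgD; apply: cvgM; [exact: c1|exact: g1|exact: c2|exact: g2].
rewrite addrC; apply/esym/eqP; rewrite subr_eq eq_sym -RintegralD//; last 3 first.
- exact: measurable_triangle.
- exact: integrable_triangle.
- exact: integrable_triangle.
apply/eqP; transitivity (Rintegral (@mu2 R) (triangle a b c) (fun x =>
  'D_(1, 0) (fun y => (v y).1 * f y) x + 'D_(0, 1) (fun y => (v y).2 * f y) x)).
  apply: eq_Rintegral => x _; apply/esym.
  apply: etrans (congr2 +%R (congr1 (@^~ x) e1) (congr1 (@^~ x) e2)) _.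
  by rewrite /divg /dot /=; ring.
rewrite RintegralD; [|exact: measurable_triangle|exact: integrable_triangle..].
by rewrite green1// green2//; move: (lint _ _) => l; ring.
Qed.

End DivergenceTheorem.

(** * Segments, cones and normals *)

Section PlaneGeometry.
Context (R : realType).
Implicit Types (a b c p u w x y z : R * R) (P U : set (R * R)).

Lemma seg_left a b : seg a b a.
Proof. by exists 0; [rewrite lexx ler01|rewrite subr0 scale1r scale0r addr0]. Qed.

Lemma segC a b : seg a b = seg b a.
Proof.
by apply/seteqP; split=> x [t /andP[t0 t1] ->]; exists (1 - t);
  rewrite ?subKr 1?addrC//; apply/andP; split; lra.
Qed.

Lemma seg_right a b : seg a b b.
Proof. by rewrite segC; exact: seg_left. Qed.

Lemma lerp_eq a b (s : R) : (1 - s) *: a + s *: b = a + s *: (b - a).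
Proof. by apply: plane_eq; rewrite !coordE; ring. Qed.

(** An end of a segment is an extreme point of it. *)
Lemma seg_extreme a b c d : seg a b = seg c d -> a = c \/ a = d.
Proof.
move=> E.
have [s /andP[s0 s1] aE] : seg c d a by rewrite -E; exact: seg_left.
have [p /andP[p0 p1] cE] : seg a b c by rewrite E; exact: seg_left.
have [q /andP[q0 q1] dE] : seg a b d by rewrite E; exact: seg_right.
move: cE dE aE; rewrite !lerp_eq => cE dE aE.
have : ((1 - s) * p + s * q) *: (b - a) = 0.
  have : (1 - s) *: (c - a) + s *: (d - a) = 0.
    have a1 := congr1 fst aE; have a2 := congr1 snd aE.
    by apply: plane_eq; move: a1 a2; rewrite !coordE /=; lra.
  have -> : c - a = p *: (b - a) by rewrite [in LHS]cE addrAC subrr add0r.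
  have -> : d - a = q *: (b - a) by rewrite [in LHS]dE addrAC subrr add0r.
  by rewrite !scalerA -scalerDl.
move=> /eqP; rewrite scaler_eq0 => /orP[/eqP k0|/eqP ba]; last first.
  by left; rewrite cE ba scaler0 addr0.
have p1' : 0 <= (1 - s) * p by apply: mulr_ge0; lra.
have q1' : 0 <= s * q by apply: mulr_ge0; lra.
have k1 : (1 - s) * p = 0 by lra.
move/eqP: k1; rewrite mulf_eq0 => /orP[/eqP s1'|/eqP p00].
  have se : s = 1 by lra.
  by right; rewrite aE se scale1r addrC subrK.
by left; rewrite cE p00 scale0r addr0.
Qed.

Lemma open_ray U x w : open U -> U x ->
  exists2 d : R, 0 < d < 1 & forall e : R, 0 <= e <= d -> U (x + e *: w).
Proof.
move=> oU Ux; move/open_nbhs_nbhs: (conj oU Ux) => /nbhs_ballP[r /= r0 rU].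
have k0 : 0 < `|w| + 1 by rewrite ltr_wpDl.
exists (Num.min (1 / 2) (r / 2 / (`|w| + 1))).
  by rewrite lt_min gt_min; apply/andP; split; [apply/andP; split; [lra|]|
    apply/orP; left; lra]; rewrite !divr_gt0.
move=> e /andP[e0]; rewrite le_min => /andP[_ ed]; apply: rU.
rewrite -ball_normE /= opprD addNKr normrN normrZ ger0_norm//.
have : e * (`|w| + 1) <= r / 2 by rewrite -ler_pdivlMr.
have := normr_ge0 w; lra.
Qed.

(** A set that is star-shaped about every point near [x] contains a cone with
tip [y] over a ball about [x], which is a neighbourhood of the open segment. *)
Lemma star_interior P x y (s : R) : (Defs.kernel P)° x -> P y -> 0 <= s < 1 ->
  P° (x + s *: (y - x)).
Proof.
move=> Kx Py /andP[s0 s1].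
have s1' : 1 - s != 0 by rewrite subr_eq0 gt_eqF.
(* [h z] is the point whose segment to [y] passes through [z] at the same ratio *)
pose h z := x + (1 - s)^-1 *: (z - (x + s *: (y - x))).
have hc : continuous h.
  move=> z; apply: cvgD; first exact: cvg_cst.
  by apply: cvgZl_tmp; apply: cvgB; [exact: cvg_id|exact: cvg_cst].
have hx : h (x + s *: (y - x)) = x by rewrite /h subrr scaler0 addr0.
have : nbhs (h (x + s *: (y - x))) (Defs.kernel P) by rewrite hx.
move=> /(hc _) hn.
have sub : h @^-1` (Defs.kernel P) `<=` P.
  move=> z [_ /(_ _ Py)]; apply; exists s; first by rewrite s0 ltW.
  by rewrite /h; apply: plane_eq; rewrite !coordE; field.
exact: (filterS sub hn).
Qed.

Lemma triangle_interior a b c x : det a b c != 0 ->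
  0 < det x b c / det a b c -> 0 < det a x c / det a b c ->
  0 < det a b x / det a b c -> (triangle a b c)° x.
Proof.
move=> d0 h1 h2 h3.
pose U := (fun x => det x b c / det a b c) @^-1` [set y | 0 < y] `&`
   ((fun x => det a x c / det a b c) @^-1` [set y | 0 < y] `&`
   (fun x => det a b x / det a b c) @^-1` [set y | 0 < y]).
have oU : open U.
  by repeat apply: openI; apply: open_comp; rewrite ?open_gt //;
    move=> ? _; apply: cvgMr_tmp; (exact: cts_det1 || exact: cts_det2 || exact: cts_det3).
apply: (@filterS _ _ _ U); last by apply: open_nbhs_nbhs; split.
by move=> z [z1 [z2 z3]]; apply/triangleP => //; split; exact: ltW.
Qed.

Lemma interior_mono P U : P `<=` U -> P° `<=` U°.
Proof. by move=> PU x; exact: filterS. Qed.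

Lemma det0_collinear a b c : det a b c = 0 -> b != a ->
  exists k : R, c - a = k *: (b - a).
Proof.
rewrite /det => d ba.
have [b1|b1] := eqVneq (b.1 - a.1) 0.
  have b2 : b.2 - a.2 != 0.
    apply: contra ba => /eqP b2; apply/eqP/plane_eq; lra.
  exists ((c.2 - a.2) / (b.2 - a.2)); apply: plane_eq; rewrite !coordE.
    have : (b.2 - a.2) * (c.1 - a.1) = 0 by rewrite b1 in d; lra.
    by move/eqP; rewrite mulf_eq0 (negbTE b2) /= b1 => /eqP ->; rewrite mulr0.
  by rewrite divfK.
exists ((c.1 - a.1) / (b.1 - a.1)); apply: plane_eq; rewrite !coordE.
  by rewrite divfK.
apply: (mulfI b1); rewrite [RHS]mulrA (mulrC _ (_ / _)) divfK//; lra.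
Qed.

Lemma nvecC a b c : nvec b a c = nvec a b c.
Proof. by rewrite /nvec det_flip sgrN; apply: plane_eq; rewrite !coordE /=; ring. Qed.

Lemma nvec_opp a b c d : Num.sg (det a b c) = - Num.sg (det a b d) ->
  nvec a b c = - nvec a b d.
Proof. by rewrite /nvec => ->; rewrite scaleNr. Qed.

(** A unit vector orthogonal to [b - a] is one of the two rotations of [b - a]
divided by its length, and being outward selects the sign. *)
Lemma outward_nvec a b c n : det a b c != 0 -> eucl n = 1 ->
  (forall x y, seg a b x -> seg a b y -> dot n (y - x) = 0) ->
  (forall x y, seg a b x -> triangle a b c y -> dot n (y - x) <= 0) ->
  eucl (b - a) *: n = nvec a b c.
Proof.
move=> d0 n1 n0 nout.
have nn : dot n n = 1.
  have n2 : 0 <= dot n n by rewrite /dot; apply: addr_ge0; rewrite -expr2 sqr_ge0.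
  by rewrite -[LHS]sqr_sqrtr// -/(eucl n) n1 expr1n.
have dn := n0 _ _ (seg_left a b) (seg_right a b).
have oc : dot n (c - a) <= 0.
  apply: nout; first exact: seg_left.
  rewrite -triangle_cycle -triangle_cycle; apply: seg_triangle; exact: seg_left.
have d2 : 0 <= dot (b - a) (b - a).
  by rewrite /dot; apply: addr_ge0; rewrite -expr2 sqr_ge0.
have l2 : eucl (b - a) ^+ 2 = dot (b - a) (b - a) by rewrite sqr_sqrtr.
have l0 : 0 <= eucl (b - a) by exact: sqrtr_ge0.
have lp : 0 < eucl (b - a).
  rewrite lt_neqAle l0 andbT eq_sym; apply: contra d0 => /eqP l00.
  move: l2; rewrite l00 expr0n /= /dot !coordE => l2.
  move/esym/eqP: l2; rewrite -!expr2 paddr_eq0 ?sqr_ge0// !sqrf_eq0.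
  move=> /andP[/eqP b1 /eqP b2].
  by rewrite /det b1 b2; apply/eqP; ring.
set l := eucl (b - a) in l2 l0 lp *.
pose k := (n.1 * (b - a).2 - n.2 * (b - a).1).
have k2 : k ^+ 2 = l ^+ 2.
  rewrite l2; transitivity (dot n n * dot (b - a) (b - a) - dot n (b - a) ^+ 2).
    by rewrite /k /dot; ring.
  by rewrite nn dn; ring.
have nE : (l ^+ 2) *: n = k *: ((b - a).2, - (b - a).1).
  rewrite l2; apply: plane_eq; rewrite !coordE /=.
    transitivity (k * (b - a).2 + dot n (b - a) * (b - a).1).
      by rewrite /k /dot !coordE; ring.
    by rewrite dn !coordE; ring.
  transitivity (- k * (b - a).1 + dot n (b - a) * (b - a).2).
    by rewrite /k /dot !coordE; ring.
  by rewrite dn !coordE; ring.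
have kd : 0 <= k * det a b c.
  have : l ^+ 2 * dot n (c - a) = - (k * det a b c).
    have n1E := congr1 fst nE; have n2E := congr1 snd nE.
    move: n1E n2E; rewrite !coordE /= => n1E n2E.
    rewrite /dot mulrDr !mulrA n1E n2E /det !coordE; ring.
  have : l ^+ 2 * dot n (c - a) <= 0 by rewrite pmulr_rle0// exprn_gt0.
  lra.
have kE : k = l * Num.sg (det a b c).
  move/eqP: k2; rewrite eqf_sqr => /orP[] /eqP kl; rewrite kl in kd *.
    have : 0 < det a b c by rewrite lt_neqAle eq_sym d0 -(pmulr_rge0 _ lp).
    by move/gtr0_sg => ->; rewrite mulr1.
  have : det a b c < 0 by rewrite lt_neqAle d0 -oppr_ge0 -(pmulr_rge0 _ lp) mulrN -mulNr.
  by move/ltr0_sg => ->; rewrite mulrN1.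
apply: (@scalerI _ _ l); first by rewrite gt_eqF.
by rewrite scalerA -expr2 nE kE /nvec scalerA.
Qed.

End PlaneGeometry.

(** * Cells and their triangles *)

Section MeshGeometry.
Context (R : realType) (Om : set (R * R)) (M : mesh Om).
Implicit Types (t d : tri M) (i : cell M) (e : set (R * R)) (x y : R * R).

Lemma ordS_neq n (j : 'I_n) : (1 < n)%N -> ordS j != j.
Proof.
move=> n1; apply/eqP => /(congr1 val) /=.
have jn := ltn_ord j; case: (ltnP j.+1 n) => jn'.
  by rewrite modn_small// => /eqP; rewrite eqn_leq ltnn.
have e : j.+1 = n by apply/eqP; rewrite eqn_leq jn jn'.
by rewrite e modnn => j0; move: n1; rewrite -e -j0.
Qed.

Lemma region_closed i : closed (region i).
Proof. by have [_ _ _ [cP _] _] := mesh_polygon i; exact: compact_closed cP. Qed.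

Lemma bnd_region i x : bnd (region i) x -> region i x.
Proof. by case=> h _; apply: region_closed. Qed.

(** A cell is the closure of its interior, so the interior of another cell near a
point of its boundary would meet its own interior. *)
Lemma interior_not_bnd i i' x : (region i)° x -> ~ bnd (region i') x.
Proof.
move=> ix [cx nx]; have [ii|ii] := eqVneq i i'; first by rewrite ii in ix.
have [_ _ _ [_ E] _] := mesh_polygon i'.
have cx' : closure (region i')° x by rewrite -E; exact: region_closed.
have [z [z1 z2]] := cx' _ (open_nbhs_nbhs (conj (@open_interior _ (region i)) ix)).
have := mesh_disj ii; move/seteqP => [+ _] => /(_ z); apply.
by split.
Qed.

Lemma nu_interior i : (region i)° (nu i).
Proof.
by apply: (interior_mono _ (mesh_star i)) => x [].
Qed.

Lemma primal_bnd t : seg (vert1 t) (vert2 t) `<=` bnd (region (tag t)).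
Proof.
by move=> x xe; have [_ _ _ _ ->] := mesh_polygon (tag t); exists (tagged t).
Qed.

Lemma apex_not_bnd t i' : ~ bnd (region i') (apex t).
Proof. by apply: interior_not_bnd; exact: nu_interior. Qed.

Lemma apex_not_primal t d : ~ seg (vert1 d) (vert2 d) (apex t).
Proof. by move/primal_bnd; exact: apex_not_bnd. Qed.

Lemma verts_neq t : vert1 t != vert2 t.
Proof.
have [n3 inj _ _ _] := mesh_polygon (tag t).
apply/eqP => /inj /esym/eqP; apply/negP/ordS_neq.
exact: leq_trans n3.
Qed.

Lemma star_int i y (s : R) : region i y -> 0 <= s < 1 ->
  (region i)° (nu i + s *: (y - nu i)).
Proof. by move=> iy s01; apply: star_interior => //; exact: mesh_star. Qed.

(** Otherwise the nearer of the two points would lie strictly between [nu i] and a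
point of the cell, hence in the interior of the cell. *)
Lemma ray_bnd i x (k : R) : bnd (region i) x ->
  bnd (region i) (nu i + k *: (x - nu i)) -> 0 < k -> k = 1.
Proof.
move=> bx by_ k0; have [k1|k1|//] := ltgtP k 1.
  exfalso; move: by_; apply: interior_not_bnd; apply: star_int.
    exact: bnd_region.
  by rewrite ltW.
exfalso; move: (bx); apply: (@interior_not_bnd i).
have -> : x = nu i + k^-1 *: ((nu i + k *: (x - nu i)) - nu i).
  by rewrite addrAC subrr add0r scalerA mulVf ?scale1r ?gt_eqF// addrCA subrr addr0.
apply: star_int; first exact: bnd_region.
by rewrite invr_ge0 (ltW k0) /= invf_lt1.
Qed.

(** If [nu i] were on the line through two consecutive vertices, then it would lie
between them, on the boundary, or a ray from [nu i] would contain both of them,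
against [ray_bnd]. *)
Lemma tri_det t : det (apex t) (vert1 t) (vert2 t) != 0.
Proof.
apply/eqP => d0.
have b1 := primal_bnd (seg_left (vert1 t) (vert2 t)).
have b2 := primal_bnd (seg_right (vert1 t) (vert2 t)).
have n1 : vert1 t != apex t by apply/eqP => E; rewrite E in b1; exact: apex_not_bnd b1.
have n2 : vert2 t != apex t by apply/eqP => E; rewrite E in b2; exact: apex_not_bnd b2.
have [k kE] := det0_collinear d0 n1.
have v2 : vert2 t = apex t + k *: (vert1 t - apex t) by rewrite -kE addrC subrK.
have [k0|k0|k0] := ltgtP k 0; last first.
- by move: n2; rewrite v2 k0 scale0r addr0 eqxx.
- have := @ray_bnd (tag t) (vert1 t) k b1; rewrite -/(apex t) -v2 => /(_ b2 k0) k1.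
  by move: (verts_neq t); rewrite v2 k1 scale1r addrC subrK eqxx.
- apply: (@apex_not_primal t t); exists (1 / (1 - k)).
    by apply/andP; split; [apply: divr_ge0; lra|rewrite ler_pdivrMr; lra].
  have k1 : 1 - k != 0 by rewrite gt_eqF//; lra.
  by rewrite v2; apply: plane_eq; rewrite !coordE; field.
Qed.

Lemma tri_sub t : tri_set t `<=` region (tag t).
Proof.
move=> x [r [s [u [r0 s0 u0 e xE]]]].
have [[_ K] _] := (nbhs_singleton (mesh_star (tag t)), tt).
have [su|su] := eqVneq (s + u) 0.
  have s00 : s = 0 by lra.
  have u00 : u = 0 by lra.
  have r1 : r = 1 by lra.
  by rewrite xE s00 u00 r1 !scale0r !addr0 scale1r; apply: interior_subset; exact: nu_interior.
have su0 : 0 < s + u by rewrite lt_neqAle eq_sym su addr_ge0.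
pose y := (1 - u / (s + u)) *: vert1 t + (u / (s + u)) *: vert2 t.
have uu : 0 <= u / (s + u) <= 1.
  by apply/andP; split; [apply: divr_ge0; lra|rewrite ler_pdivrMr//; lra].
have ry : region (tag t) y by apply/bnd_region/primal_bnd; exists (u / (s + u)).
apply: (K _ ry); exists (s + u); first by apply/andP; split; lra.
rewrite xE (_ : r = 1 - (s + u)); last by lra.
by rewrite /y /apex; apply: plane_eq; rewrite !coordE; field.
Qed.

(** Edges of one polygon meet at vertices only, so a common midpoint identifies them. *)
Lemma primal_same_cell t d : tag t = tag d ->
  seg (vert1 t) (vert2 t) = seg (vert1 d) (vert2 d) -> t = d.
Proof.
case: t d => i j [i' j'] /= ii; move: j'; case: _ / ii => j' E.
have [->//|jj] := eqVneq j j'; exfalso.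
have [_ _ P _ _] := mesh_polygon i.
pose t : tri M := Tagged (fun i => 'I_(nv i)) j.
pose m := (1 - 1 / 2) *: vert1 t + (1 / 2 : R) *: vert2 t.
have sm : seg (vert1 t) (vert2 t) m by exists (1 / 2) => //; lra.
have := P _ _ jj m; case.
  split; first exact: sm.
  by rewrite -/(vert1 (Tagged (fun i => 'I_(nv i)) j')); rewrite E in sm; exact: sm.
rewrite -/(vert1 t) => mE _; apply: (negP (verts_neq t)); apply/eqP.
by case: mE => /= mE; have := congr1 fst mE; have := congr1 snd mE;
  rewrite /m !coordE => h1 h2; apply: plane_eq; lra.
Qed.

End MeshGeometry.

(** * Triangles that share an edge *)

Section Neighbours.
Context (R : realType) (Om : set (R * R)) (M : mesh Om).
Implicit Types (t d : tri M) (i : cell M) (e : set (R * R)) (x y : R * R).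

Definition primal t : set (R * R) := seg (vert1 t) (vert2 t).

(** The triangle on the other side of the dual edge with index [t]. *)
Definition prev_tri t : tri M := Tagged (fun i => 'I_(nv i)) (ord_pred (tagged t)).

Lemma apex_prev t : apex (prev_tri t) = apex t. Proof. by []. Qed.

Lemma vert2_prev t : vert2 (prev_tri t) = vert1 t.
Proof. by rewrite /vert2 /vert1 /prev_tri /= ord_predK. Qed.

Lemma prev_bij : bijective prev_tri.
Proof.
exists (fun t => Tagged (fun i => 'I_(nv i)) (ordS (tagged t))).
  by case=> i j; rewrite /prev_tri /= ord_predK.
by case=> i j; rewrite /prev_tri /= ordSK.
Qed.

Lemma prev_neq t : prev_tri t != t.
Proof.
apply/eqP => E; have := verts_neq t.
by rewrite -{2}E vert2_prev eqxx.
Qed.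

(** Close to the midpoint of [a b], on the segment from there to [n], the barycentric
coordinates for both triangles are positive. *)
Lemma same_side_overlap (n n' a b : R * R) : 0 < det n a b * det n' a b ->
  exists x, (triangle n a b)° x /\ (triangle n' a b)° x.
Proof.
move=> s0.
have [d0 d0'] : det n a b != 0 /\ det n' a b != 0.
  by split; apply: contraTneq s0 => ->; rewrite ?mul0r ?mulr0 ltxx.
pose m := (1 - 1 / 2) *: a + (1 / 2 : R) *: b.
pose x (e : R) := m + e *: (n - m).
pose k1 := det n' n b / det n' a b - 1 / 2.
pose k2 := det n' a n / det n' a b - 1 / 2.
(* this step is so short that two barycentric coordinates, equal to 1/2 at the *)
(* midpoint, stay positive *)
pose e : R := (3 + 2 * `|k1| + 2 * `|k2|)^-1.
have h1 := normr_ge0 k1; have h2 := normr_ge0 k2.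
have den : 0 < 3 + 2 * `|k1| + 2 * `|k2| by lra.
have e0 : 0 < e by rewrite invr_gt0.
have ee : e * 3 + 2 * (e * `|k1|) + 2 * (e * `|k2|) = 1.
  transitivity (e * (3 + 2 * `|k1| + 2 * `|k2|)); first by ring.
  by rewrite mulVf// gt_eqF.
have p1 : 0 <= e * `|k1| by rewrite mulr_ge0// ltW.
have p2 : 0 <= e * `|k2| by rewrite mulr_ge0// ltW.
have bnd (k : R) : e * - `|k| <= e * k.
  by rewrite ler_pM2l// lerNl; rewrite -normrN ler_norm.
have q1 := bnd k1; have q2 := bnd k2.
exists (x e); split; apply: triangle_interior => //.
- rewrite (_ : det (x e) a b / _ = e)//.
  by rewrite /x /m /det !coordE; move: d0; rewrite /det => d0; field.
- rewrite (_ : det n (x e) b / _ = (1 - e) / 2); first by lra.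
  by rewrite /x /m /det !coordE; move: d0; rewrite /det => d0; field.
- rewrite (_ : det n a (x e) / _ = (1 - e) / 2); first by lra.
  by rewrite /x /m /det !coordE; move: d0; rewrite /det => d0; field.
- rewrite (_ : det (x e) a b / _ = e * (det n a b / det n' a b)); last first.
    by rewrite mulrA; congr (_ / _); rewrite /x /m /det !coordE; field.
  apply: mulr_gt0 => //.
  have -> : det n a b / det n' a b = det n a b * det n' a b / det n' a b ^+ 2 by field.
  by rewrite divr_gt0// exprn_even_gt0.
- rewrite (_ : det n' (x e) b / _ = 1 / 2 + e * k1); first by lra.
  by rewrite /k1 /x /m /det !coordE; move: d0'; rewrite /det => d0'; field.
- rewrite (_ : det n' a (x e) / _ = 1 / 2 + e * k2); first by lra.
  by rewrite /k2 /x /m /det !coordE; move: d0'; rewrite /det => d0'; field.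
Qed.

Lemma sg_opp (p q : R) : p != 0 -> q != 0 -> ~ (0 < p * q) ->
  Num.sg p = - Num.sg q.
Proof.
move=> p0 q0 /negP; rewrite -leNgt le_eqVlt mulf_eq0 (negbTE p0) (negbTE q0) /=.
move=> /ltr0_sg; rewrite sgrM => E.
apply: (mulIf (x := Num.sg q)); first by rewrite sgr_eq0.
by rewrite E mulNr -sgrM -expr2 sgrX sqr_sg q0.
Qed.

(** On the same side of the edge the two triangles would overlap, whereas they
belong to different cells. *)
Lemma primal_opposite t d a b : t != d -> primal t = primal d ->
  primal t = seg a b -> det (apex t) a b != 0 /\ det (apex d) a b != 0 /\
  Num.sg (det (apex t) a b) = - Num.sg (det (apex d) a b).
Proof.
move=> td E Eab.
have nz t' : primal t' = seg a b -> tri_set t' = triangle (apex t') a b /\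
    det (apex t') a b != 0.
  move=> E'.
  have := seg_extreme E'; have := seg_extreme (etrans (segC _ _) E').
  have vn := verts_neq t'; have dn := tri_det t'.
  case=> v2 [] v1.
  - by rewrite v1 v2 eqxx in vn.
  - split; first by rewrite /tri_set v1 v2 -triangle_cycle triangle_flip -triangle_cycle -triangle_cycle.
    have det23 (p q r : R * R) : det p r q = - det p q r by rewrite /det; ring.
    by move: dn; rewrite v1 v2 det23 oppr_eq0.
  - by rewrite /tri_set -v1 -v2.
  - by rewrite v1 v2 eqxx in vn.
have [T1 d1] := nz t Eab; have [T2 d2] := nz d (etrans (esym E) Eab).
split=> //; split=> //; apply: sg_opp => // s0.
have [x [x1 x2]] := same_side_overlap s0.
have tgd : tag t != tag d.
  by apply: contra td => /eqP /primal_same_cell /(_ E) ->.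
have := mesh_disj tgd; move/seteqP => [+ _] => /(_ x); apply; split.
  by move: x1; rewrite -T1; apply: interior_mono; exact: tri_sub.
by move: x2; rewrite -T2; apply: interior_mono; exact: tri_sub.
Qed.

(** Three triangles cannot be pairwise on opposite sides of one line. *)
Lemma primal_unique t d d' : d != t -> d' != t ->
  primal d = primal t -> primal d' = primal t -> d = d'.
Proof.
move=> dt dt' E E'; have [//|dd] := eqVneq d d'; exfalso.
have [d0 [_ e1]] := primal_opposite dt E E.
have [_ [_ e2]] := primal_opposite dt' E' E'.
have [_ [_ e3]] := primal_opposite dd (etrans E (esym E')) E.
move: e1; rewrite e3 e2 opprK => e4.
have : Num.sg (det (apex t) (vert1 t) (vert2 t)) = 0 by lra.
by move/eqP; rewrite sgr_eq0; apply/negP; exact: tri_det.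
Qed.

(** A small move from [x0] towards the midpoint of the edge stays in [Om] and avoids
the vertices. *)
Lemma edge_point (t0 : tri M) x0 : open Om -> primal t0 x0 -> ~ bnd Om x0 ->
  exists2 x, Om x & exists2 s : R, 0 < s < 1 &
    x = (1 - s) *: vert1 t0 + s *: vert2 t0.
Proof.
move=> oO x0e nb.
have cx : closure Om x0.
  rewrite (mesh_cover M); exists (tag t0) => //.
  by apply/bnd_region/primal_bnd.
have Ox0 : Om x0.
  by apply: contrapT => nO; apply: nb; split=> // /interior_subset.
have [s0 /andP[s00 s01] xE] := x0e.
have [d /andP[d0 d1] hd] := open_ray ((1 / 2 - s0) *: (vert2 t0 - vert1 t0)) oO Ox0.
exists (x0 + d *: ((1 / 2 - s0) *: (vert2 t0 - vert1 t0))).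
  by apply: hd; rewrite (ltW d0) lexx.
exists (s0 + d * (1 / 2 - s0)).
  have h1 : 0 <= (1 - d) * s0 by apply: mulr_ge0; lra.
  have h2 : 0 <= (1 - d) * (1 - s0) by apply: mulr_ge0; lra.
  by apply/andP; split; lra.
by rewrite xE; apply: plane_eq; rewrite !coordE; ring.
Qed.

(** Behind an edge that is not contained in the boundary of [Om], the points
close to the edge belong to another cell, and conformity makes the edge one of
its edges. *)
Lemma primal_neighbour t : open Om -> ~ (primal t `<=` bnd Om) ->
  exists2 d, d != t & primal d = primal t.
Proof.
move=> oO /existsNP[x0 /not_implyP[x0e nb]].
have [x Ox [s s01 xE]] := edge_point oO x0e nb.
have xe : primal t x by exists s => //; move: s01 => /andP[s0 s1]; rewrite !ltW.
have xb := primal_bnd xe.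
have [i' ii xi'] : exists2 i', i' != tag t & region i' x.
  apply: contrapT => no.
  (* if no other cell contained [x], then the points just behind [x] on the ray *)
  (* from the apex would be in the cell of [t], and [x] in its interior *)
  pose F := \bigcup_(i' in [set i' | i' != tag t]) region i'.
  have oV : open (Om `&` ~` F).
    apply: openI => //; apply: closed_openC; apply: closed_bigcup => [|i' _].
      by apply: (@sub_finite_set _ _ setT) => //; exact: finite_finset.
    exact: region_closed.
  have Vx : (Om `&` ~` F) x by split=> // -[i' ii' xi']; apply: no; exists i'.
  have [d /andP[d0 d1] hd] := open_ray (x - apex t) oV Vx.
  have [Oy Fy] : (Om `&` ~` F) (x + d *: (x - apex t)) by apply: hd; rewrite (ltW d0) lexx.
  have : closure Om (x + d *: (x - apex t)) by exact: subset_closure.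
  rewrite (mesh_cover M) => -[i' _ yi'].
  have [ii|ii] := eqVneq i' (tag t); last by apply: Fy; exists i'.
  subst i'; move: xb; apply: (@interior_not_bnd _ _ _ (tag t)).
  have -> : x = nu (tag t) + (1 + d)^-1 *: (x + d *: (x - apex t) - nu (tag t)).
    by rewrite /apex; apply: plane_eq; rewrite !coordE; field; rewrite gt_eqF//; lra.
  apply: star_int => //.
  by apply/andP; split; [rewrite invr_ge0|rewrite invf_lt1]; lra.
have : bnd (region i') x.
  split; first exact: subset_closure.
  by move=> ix; apply: interior_not_bnd xb; exact: ix.
have [_ _ _ _ ->] := mesh_polygon i'; move=> [j' _ xj'].
pose d : tri M := Tagged (fun i => 'I_(nv i)) j'.
exists d; first by apply/eqP => E; move: ii; rewrite -E eqxx.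
have [E|sub] := mesh_conform (tagged t) j'; first by rewrite /primal E.
exfalso; have [+ _] := sub x (conj xe xj').
have nv := verts_neq t.
have h : (vert2 t - vert1 t == 0) = false by rewrite subr_eq0 eq_sym (negbTE nv).
move: s01 => /andP[s0 s1]; rewrite -/(vert1 t) -/(vert2 t) => -[] /= xv.
  have : s *: (vert2 t - vert1 t) = 0.
    by apply: (addrI (vert1 t)); rewrite -lerp_eq -xE addr0.
  by move/eqP; rewrite scaler_eq0 h orbF gt_eqF.
have : (1 - s) *: (vert2 t - vert1 t) = 0.
  by rewrite scalerBl scale1r; apply/eqP; rewrite subr_eq0; apply/eqP;
    apply: (addrI (vert1 t)); rewrite -lerp_eq -xE xv addrC subrK.
by move/eqP; rewrite scaler_eq0 h orbF gt_eqF//; lra.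
Qed.

Lemma vert1_inj t d : tag t = tag d -> vert1 t = vert1 d -> t = d.
Proof.
case: t d => i j [i' j'] /= ii; move: j'; case: _ / ii => j'.
by have [_ inj _ _ _] := mesh_polygon i; rewrite /vert1 /= => /inj ->.
Qed.

Lemma tri_edge_primal t d : tri_edge t (primal d) -> primal t = primal d.
Proof.
case=> [->//|E|E]; exfalso; apply: (@apex_not_primal _ _ _ t d);
  by rewrite -/(primal d) E; exact: seg_left.
Qed.

(** An apex is never on the boundary of a cell, so equal edges through an apex have
the same apex and the same vertex. *)
Lemma tri_edge_dual t d : tri_edge t (dual_edge d) <-> t = d \/ t = prev_tri d.
Proof.
split; last first.
  by case=> ->; [apply: Or32|apply: Or33; rewrite apex_prev vert2_prev].
have b1 t' : bnd (region (tag t')) (vert1 t') by apply: primal_bnd; exact: seg_left.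
have b2 t' : bnd (region (tag t')) (vert2 t') by apply: primal_bnd; exact: seg_right.
have same_apex t' p : (bnd (region (tag t')) p) -> dual_edge d = seg (apex t') p ->
    tag d = tag t' /\ vert1 d = p.
  move=> bp E.
  have A : apex d = apex t'.
    by case: (seg_extreme E) => // e; move: bp; rewrite -e => /apex_not_bnd.
  split.
    apply/eqP; apply: contraT => /mesh_disj /seteqP[+ _] => /(_ (apex d)); case.
    by split; [exact: nu_interior|rewrite A; exact: nu_interior].
  case: (seg_extreme (etrans (segC _ _) E)) => // e.
  by move: (b1 d); rewrite e => /apex_not_bnd.
case=> [E|E|E].
- by exfalso; apply: (@apex_not_primal _ _ _ d t); rewrite -E; exact: seg_left.
- by have [] := same_apex t _ (b1 t) E; left; apply/esym; exact: vert1_inj.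
- have [tE vE] := same_apex t _ (b2 t) E; right.
  pose s : tri M := Tagged (fun i => 'I_(nv i)) (ordS (tagged t)).
  have -> : d = s by apply: vert1_inj.
  by case: (t) @s => i j /=; rewrite /prev_tri /= ordSK.
Qed.

(** If the two triangles at a dual edge were on the same side of it, the ray
through a point of one of their primal edges would meet the other one too. *)
Lemma dual_opposite d :
  Num.sg (det (apex d) (vert1 d) (vert2 d)) =
  - Num.sg (det (apex d) (vert1 d) (vert1 (prev_tri d))).
Proof.
set n := apex d; set p := vert1 d; set u := vert2 d; set w := vert1 (prev_tri d).
have du : det n p u != 0 by exact: tri_det.
have dw : det n p w != 0.
  have := tri_det (prev_tri d); rewrite apex_prev vert2_prev -/n -/p -/w.
  by rewrite (_ : det n w p = - det n p w) ?oppr_eq0// /det; ring.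
apply: sg_opp => // s0.
pose be := det n p u / det n p w.
pose al := det n u w / det n p w.
have be0 : 0 < be.
  have -> : be = det n p u * det n p w / det n p w ^+ 2 by rewrite /be; field.
  by rewrite divr_gt0// exprn_even_gt0.
have uE : u = n + (al *: (p - n) + be *: (w - n)).
  rewrite /al /be; apply: plane_eq; rewrite !coordE; move: dw; rewrite /det => dw;
    by field.
(* [z] is so close to [p] that the ray through it still meets the edge [w p] *)
pose e : R := (2 + `|al|)^-1.
have a0 := normr_ge0 al.
have e0 : 0 < e by rewrite invr_gt0; lra.
have ee : 2 * e + e * `|al| = 1.
  transitivity (e * (2 + `|al|)); first by ring.
  by rewrite mulVf// gt_eqF//; lra.
have ea : - (e * `|al|) <= e * al.
  by rewrite -mulrN ler_pM2l// lerNl -normrN ler_norm.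
have eb : 0 < e * be by exact: mulr_gt0.
have ena : 0 <= e * `|al| by rewrite mulr_ge0// ltW.
pose la := 1 - e + e * al + e * be.
have la0 : 0 < la by rewrite /la; lra.
pose z := (1 - e) *: p + e *: u.
pose z' := (1 - e * be / la) *: p + (e * be / la) *: w.
have zE : z = n + la *: (z' - n).
  rewrite /z /z' uE; apply: plane_eq; rewrite !coordE /la; move: la0; rewrite /la => la0;
    by field; rewrite gt_eqF.
have zs : seg p u z by exists e => //; apply/andP; split; lra.
have zs' : seg w p z'.
  rewrite segC; exists (e * be / la) => //; apply/andP; split.
    by rewrite divr_ge0// ltW.
  by rewrite ler_pdivrMr// mul1r /la; lra.
have bz : bnd (region (tag d)) z by exact: primal_bnd.
have bz' : bnd (region (tag d)) z'.
  by apply: (@primal_bnd _ _ _ (prev_tri d)); rewrite vert2_prev.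
have la1 : la = 1 by apply: (ray_bnd bz') => //; rewrite -[nu _]/n -zE.
have zz : z = z' by rewrite zE la1 scale1r addrC subrK.
have [_ _ P _ _] := mesh_polygon (tag d).
have jj : ord_pred (tagged d) != tagged d.
  apply: contra (prev_neq d) => /eqP E.
  by rewrite /prev_tri E; case: (d).
have zw : seg (vtx (ord_pred (tagged d))) (vtx (ordS (ord_pred (tagged d)))) z.
  by rewrite ord_predK zz.
have [_ /= zu] := P _ _ jj z (conj zw zs).
have pu : (u - p == 0) = false by rewrite subr_eq0 eq_sym (negbTE (verts_neq d)).
case: zu => [zp|zu].
  have : e *: (u - p) = 0 by apply: (addrI p); rewrite -lerp_eq -/z zp addr0.
  by move/eqP; rewrite scaler_eq0 pu orbF gt_eqF.
have : (1 - e) *: (u - p) = 0.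
  rewrite scalerBl scale1r; apply/eqP; rewrite subr_eq0; apply/eqP.
  by apply: (addrI p); rewrite -lerp_eq -/z zu addrC subrK.
by move/eqP; rewrite scaler_eq0 pu orbF gt_eqF//; lra.
Qed.

End Neighbours.

(** * Null sets and square integrability *)

Section NullSets.
Context (R : realType).
Implicit Types (f g : R * R -> R) (a b c x : R * R) (A D : set (R * R)).

Lemma measurable_line b c : measurable ([set x | det x b c = 0] : set (plane R)).
Proof.
apply: measurable_closed; apply: (@preimage_closed _ _ (fun x => det x b c) [set 0]).
  by move=> x _; exact: cts_det1.
exact: closed_eq.
Qed.

(** A vertical line is a product with a null set; any other line has one-point sections. *)
Lemma mu2_line b c : b != c -> (@mu2 R) ([set x | det x b c = 0] : set (plane R)) = 0%E.
Proof.
move=> bc; set A := [set x | _].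
have mA : measurable (A : set (plane R)) by exact: measurable_line.
have [c1|c1] := eqVneq (c.1 - b.1) 0.
  have c2 : c.2 - b.2 != 0.
    by apply: contra bc => /eqP c2; apply/eqP/plane_eq; lra.
  have -> : A = [set b.1] `*` setT.
    apply/seteqP; split => x; rewrite /A /det /=.
      have -> : c.1 = b.1 by lra.
      move=> E; split => //; apply: (mulIf c2); lra.
    move=> [/= -> _]; have -> : c.1 = b.1 by lra.
      by ring.
  rewrite /mu2 product_measure1E; [|exact: measurable_set1|exact: measurableT].
  transitivity (0 * leb R setT)%E; last exact: mul0e.
  by congr (_ * _)%E; exact: lebesgue_measure_set1.
rewrite /mu2 /= /product_measure1; apply: integral0_eq => x _ /=.
apply: (@subset_measure0 _ _ _ (leb R) _
  [set b.2 + (x - b.1) * (c.2 - b.2) / (c.1 - b.1)]) => //.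
- exact: measurable_xsection.
- move=> y; rewrite /xsection /= inE /A /det /= => E.
  apply: (mulIf c1); rewrite mulrDl divfK//; lra.
- exact: lebesgue_measure_set1.
Qed.

(** A triangle differs from its interior by parts of three lines. *)
Lemma triangle_boundary_null a b c : det a b c != 0 ->
  (@mu2 R) (triangle a b c `\` (triangle a b c)° : set (plane R)) = 0%E.
Proof.
move=> d0.
have mT := measurable_triangle d0.
have mI : measurable ((triangle a b c)° : set (plane R)).
  by apply: measurable_open; exact: open_interior.
have mL p q := measurable_line p q.
have bc : b != c by apply: contra d0 => /eqP ->; apply/eqP; rewrite /det; ring.
have ca : c != a by apply: contra d0 => /eqP ->; apply/eqP; rewrite /det; ring.
have ab : a != b by apply: contra d0 => /eqP ->; apply/eqP; rewrite /det; ring.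
apply: (@subset_measure0 _ _ _ (@mu2 R) _ ([set x | det x b c = 0] `|`
  ([set x | det x c a = 0] `|` [set x | det x a b = 0]) : set (plane R))) => //.
- exact: measurableD.
- by apply: measurableU => //; exact: measurableU.
- move=> x [/(triangleP x d0) [h1 h2 h3] nI].
  apply: contrapT => /not_orP[n1 /not_orP[n2 n3]]; apply: nI.
  have z (p : R) : 0 <= p / det a b c -> p <> 0 -> 0 < p / det a b c.
    move=> h np; rewrite lt_neqAle h andbT eq_sym mulf_neq0 ?invr_eq0//.
    exact/eqP.
  apply: triangle_interior => //; apply: z => //.
    by rewrite -(det_cycle a x).
  by rewrite (det_cycle x).
- have U (P Q : set (plane R)) : measurable P -> measurable Q ->
      (@mu2 R) P = 0%E -> (@mu2 R) Q = 0%E -> (@mu2 R) (P `|` Q) = 0%E.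
    move=> mP mQ P0 Q0.
    exact: etrans (@measureU0 _ _ _ (leb R \x leb R)%E _ _ mP mQ Q0) P0.
  apply: (U) => //; first exact: measurableU.
    exact: mu2_line.
  by apply: (U) => //; exact: mu2_line.
Qed.

Lemma Rintegral_interior_triangle a b c f : det a b c != 0 -> continuous f ->
  Rintegral (@mu2 R) (triangle a b c)° f = Rintegral (@mu2 R) (triangle a b c) f.
Proof.
move=> d0 cf; rewrite /Rintegral; congr fine.
have mT := measurable_triangle d0.
have mI : measurable ((triangle a b c)° : set (plane R)).
  by apply: measurable_open; exact: open_interior.
apply/esym.
have mN : measurable (triangle a b c `\` (triangle a b c)° : set (plane R)).
  exact: measurableD.
apply: (etrans (@negligible_integral _ _ _ (leb R \x leb R)%E _ _ _ mN mT
  (integrable_triangle d0 cf) (triangle_boundary_null d0))).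
congr (integral _ _ _); rewrite setDD setIC.
by apply: setIidl; exact: interior_subset.
Qed.

Lemma mu2_open_gt0 D : open D -> D !=set0 -> (0 < (@mu2 R) (D : set (plane R)))%E.
Proof.
move=> oD [x Dx]; move/open_nbhs_nbhs: (conj oD Dx) => /nbhs_ballP[r /= r0 rD].
apply: (@lt_le_trans _ _ ((@mu2 R) (box x r : set (plane R)))).
  have L (u v : R) : u < v -> (0 < leb R (`]u, v[%classic)%R)%E.
    by move=> uv; rewrite lebesgue_measure_itv /= lte_fin uv -EFinD lte_fin subr_gt0.
  rewrite /mu2 /box product_measure1E; [|exact: measurable_itv..].
  by apply: mule_gt0; apply: L; lra.
apply: le_measure; rewrite ?inE; [exact: measurable_box|exact: measurable_open|].
by move=> y /box_ball; exact: rD.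
Qed.

Lemma L2_piece f D : continuous f -> measurable (D : set (plane R)) ->
  bounded_set D -> (f \_ D : plane R -> R) \in Lfun (@mu2 R) 2%:E.
Proof.
move=> cf mD bD.
have mf : measurable_fun (setT : set (plane R)) (f \_ D).
  apply/(measurable_restrictT _ _).1 => //.
  exact: measurable_funS (continuous_measurable2 cf).
rewrite inE; apply/andP; split; rewrite inE //=.
rewrite /finite_norm unlock /= poweR_lty//.
have c2 : continuous (fun x => f x * f x) by move=> x; apply: cvgM; exact: cf.
have := continuous_integrable2 c2 mD bD.
move=> /(integrable_mkcond _ mD).1 /integrableP[_]; apply: le_lt_trans.
rewrite le_eqVlt; apply/orP; left; apply/eqP; apply: eq_integral => x _.
rewrite !patchE; case: ifPn => _ /=.
  by rewrite powR_mulrn// -expr2 normrX.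
by rewrite normr0 powR0.
Qed.

End NullSets.

(** * Integration by parts in the bilinear form *)

Section Forms.
Context (R : realType) (Om : set (R * R)) (M : mesh Om) (o : orientation M).
Implicit Types (t d : tri M) (e : set (R * R)) (x y : R * R).
Implicit Types (q : tri M -> R * R -> R) (v : tri M -> R * R -> R * R).

(** The choice in [jump] is forced, since [d] is the only other triangle at [e]. *)
Lemma jump_pair e t d q x : (forall s, tri_edge s e <-> s = t \/ s = d) ->
  t != d -> tau_plus o e = t -> jump o e q x = q t x - q d x.
Proof.
move=> he td te; rewrite /jump te; case: pickP => [s|no].
  move=> /andP[st /asboolP /he [E|->//]]; by rewrite E eqxx in st.
have := no d; rewrite eq_sym td /= => /asboolP; case; apply/he; by right.
Qed.

Lemma lint_seg (a b a0 b0 : R * R) (f : R * R -> R) : continuous f -> a != b ->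
  seg a b = seg a0 b0 -> lint a b f = lint a0 b0 f.
Proof.
move=> cf ab E.
have := seg_extreme E; have := seg_extreme (etrans (segC _ _) E).
case=> b' [] a'; rewrite a' b'; rewrite a' b' ?eqxx in ab => //.
exact: lintC.
Qed.

Definition out_normal t : R * R := nvec (vert1 t) (vert2 t) (apex t).

Definition primal_flux v t (f : R * R -> R) : R :=
  lint (vert1 t) (vert2 t) (fun x => dot (v t x) (out_normal t) * f x).

Lemma tri_det_prev d : det (apex d) (vert1 d) (vert1 (prev_tri d)) != 0.
Proof.
have := tri_det (prev_tri d); rewrite apex_prev vert2_prev.
by rewrite (_ : det _ (vert1 (prev_tri d)) _ =
  - det (apex d) (vert1 d) (vert1 (prev_tri d))) ?oppr_eq0// /det; ring.
Qed.

Lemma dual_nvec d : nvec (apex d) (vert1 d) (vert1 (prev_tri d)) =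
  - nvec (apex d) (vert1 d) (vert2 d).
Proof. by apply: nvec_opp; rewrite dual_opposite opprK. Qed.

(** The normal of a dual edge is outward for [tau_plus], and the normals of the two
triangles at this edge are opposite. *)
Lemma dual_plus d : let e := dual_edge d in
  (tau_plus o e = d /\
    eucl (vert1 d - apex d) *: nrm o e = nvec (apex d) (vert1 d) (vert2 d)) \/
  (tau_plus o e = prev_tri d /\
    eucl (vert1 d - apex d) *: nrm o e = - nvec (apex d) (vert1 d) (vert2 d)).
Proof.
move=> e.
have he : (primal_edges M `|` dual_edges M) e by right; exists d.
have [n1 n2 n3] := orient_nrm o he.
case: ((tri_edge_dual _ _).1 (orient_edge o he)) => E; [left|right];
  split=> //; rewrite E in n3.
  by apply: outward_nvec => //; exact: tri_det.
rewrite -dual_nvec; apply: outward_nvec => //; first exact: tri_det_prev.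
move=> x y xe yt; apply: n3 => //; rewrite /tri_set apex_prev vert2_prev.
by move: yt; rewrite -triangle_cycle triangle_flip triangle_cycle.
Qed.

Lemma jump_dual d q x :
  (tau_plus o (dual_edge d) = d -> jump o (dual_edge d) q x = q d x - q (prev_tri d) x) /\
  (tau_plus o (dual_edge d) = prev_tri d -> jump o (dual_edge d) q x = q (prev_tri d) x - q d x).
Proof.
split=> E; apply: jump_pair => //.
- by move=> s; apply: tri_edge_dual.
- by rewrite eq_sym; exact: prev_neq.
- by move=> s; rewrite tri_edge_dual; split=> -[]; tauto.
- exact: prev_neq.
Qed.

(** The normal component of [v] is the same from both sides of the dual edge, so the
value from [tau_plus] may be replaced by the one from the other triangle in the
term that contains the value of [q] on that triangle. *)
Lemma dual_term v q d : (forall t, C1v (v t)) -> (forall t, continuous (q t)) ->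
  (forall x, dual_edge d x ->
     jump o (dual_edge d) (fun t y => dot (v t y) (nrm o (dual_edge d))) x = 0) ->
  seg_int (apex d) (vert1 d) (fun x => let e := dual_edge d in
     dot (v (tau_plus o e) x) (nrm o e) * jump o e q x) =
  lint (apex d) (vert1 d)
    (fun x => dot (v d x) (nvec (apex d) (vert1 d) (vert2 d)) * q d x) +
  lint (vert2 (prev_tri d)) (apex (prev_tri d))
    (fun x => dot (v (prev_tri d) x)
       (nvec (vert2 (prev_tri d)) (apex (prev_tri d)) (vert1 (prev_tri d))) * q (prev_tri d) x).
Proof.
move=> Cv cq hv; rewrite apex_prev vert2_prev [nvec (vert1 d) _ _]nvecC dual_nvec.
rewrite [X in _ = _ + X]lintC; last exact: cts_flux.
rewrite -lintD; [|exact: cts_flux..].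
have cj : continuous (jump o (dual_edge d) q).
  have [[E _]|[E _]] := dual_plus d.
    rewrite (_ : jump _ _ _ = (fun x => q d x - q (prev_tri d) x)); last first.
      by apply/funext => x; exact: (jump_dual d q x).1.
    by move=> x; apply: cvgB; exact: cq.
  rewrite (_ : jump _ _ _ = (fun x => q (prev_tri d) x - q d x)); last first.
    by apply/funext => x; exact: (jump_dual d q x).2.
  by move=> x; apply: cvgB; exact: cq.
pose F x := dot (v (tau_plus o (dual_edge d)) x) (nrm o (dual_edge d)) *
  jump o (dual_edge d) q x.
transitivity (eucl (vert1 d - apex d) * lint (apex d) (vert1 d) F); first by [].
rewrite -lintZ; last by apply: cts_flux.
rewrite /F.
apply: eq_lint => x xe; have := hv x xe.
have [j1 j2] := jump_dual d q x.
have [k1 k2] := jump_dual d (fun t y => dot (v t y) (nrm o (dual_edge d))) x.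
have dotZ (k : R) (p n : R * R) : k * dot p n = dot p (k *: n).
  by rewrite /dot !coordE; ring.
have dotN (p n : R * R) : dot p (- n) = - dot p n by rewrite /dot !coordE; ring.
have [[E nE]|[E nE]] := dual_plus d; rewrite E.
- rewrite (k1 E) (j1 E) => h; rewrite mulrA dotZ nE.
  have : eucl (vert1 d - apex d) * dot (v d x) (nrm o (dual_edge d)) =
    eucl (vert1 d - apex d) * dot (v (prev_tri d) x) (nrm o (dual_edge d)).
    by congr (_ * _); apply/eqP; rewrite -subr_eq0 h.
  by rewrite !dotZ nE dotN => ->; ring.
rewrite (k2 E) (j2 E) => h; rewrite mulrA dotZ nE.
have : eucl (vert1 d - apex d) * dot (v d x) (nrm o (dual_edge d)) =
  eucl (vert1 d - apex d) * dot (v (prev_tri d) x) (nrm o (dual_edge d)).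
  by congr (_ * _); apply/esym/eqP; rewrite -subr_eq0 h.
by rewrite !dotZ nE !dotN => /oppr_inj ->; ring.
Qed.

(** Integration by parts on every triangle; the dual edges drop out since each of
them is shared by two triangles with opposite normals, so only the divergence
and the primal edges remain. *)
Lemma bh_parts k v q : Vh o k v -> (forall t, C1 (q t)) ->
  bh o v q = \sum_(t : tri M) (Rintegral (@mu2 R) (tri_set t)
    (fun x => divg (v t) x * q t x) - primal_flux v t (q t)).
Proof.
move=> [v1 v2 vj] Cq.
have Cv t : C1v (v t).
  by split; [exact: is_poly_C1 (v1 t)|exact: is_poly_C1 (v2 t)].
have cq t : continuous (q t) by exact: C1_cts.
pose D1 t := lint (apex t) (vert1 t)
  (fun x => dot (v t x) (nvec (apex t) (vert1 t) (vert2 t)) * q t x).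
pose D2 t := lint (vert2 t) (apex t)
  (fun x => dot (v t x) (nvec (vert2 t) (apex t) (vert1 t)) * q t x).
have -> : bh o v q = - (\sum_(t : tri M) (- Rintegral (@mu2 R) (tri_set t)
    (fun x => divg (v t) x * q t x) + (D1 t + primal_flux v t (q t) + D2 t))) +
    \sum_(d : tri M) (D1 d + D2 (prev_tri d)).
  rewrite /bh; congr (- _ + _); apply: eq_bigr => t _.
    exact: triangle_parts (tri_det t).
  apply: dual_term => // x xe; apply: vj => //; by exists t.
have -> : \sum_(d : tri M) (D1 d + D2 (prev_tri d)) = \sum_(d : tri M) (D1 d + D2 d).
  rewrite !big_split /=; congr (_ + _).
  by rewrite [RHS](reindex_inj (bij_inj (prev_bij M))).
rewrite -sumrN -big_split /=; apply: eq_bigr => t _.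
by move: (D1 t) (D2 t) (primal_flux _ _ _) => x y z; ring.
Qed.

End Forms.

(** * Integrals of glued functions *)

Section Glue.
Context (R : realType) (Om : set (R * R)) (M : mesh Om).
Context (openOm : open Om) (bdOm : bounded_set Om).
Implicit Types (t d : tri M) (x y : R * R).
Implicit Types (q : tri M -> R * R -> R) (v : tri M -> R * R -> R * R).

Let mOm : measurable (Om : set (plane R)).
Proof. exact: measurable_open. Qed.

Let mI t : measurable ((tri_set t)° : set (plane R)).
Proof. by apply: measurable_open; exact: open_interior. Qed.

Lemma glueE q : Defs.glue q = (fun x => \sum_(t : tri M) (q t \_ (tri_set t)°) x).
Proof.
apply/funext => x; rewrite /Defs.glue big_mkcond; apply: eq_bigr => t _.
by rewrite patchE.
Qed.

Lemma Rintegral_sum (D : set (R * R)) (s : seq (tri M)) q :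
  measurable (D : set (plane R)) ->
  (forall t, (@mu2 R).-integrable (D : set (plane R)) (EFin \o q t)) ->
  (@mu2 R).-integrable (D : set (plane R)) (EFin \o (fun x => \sum_(t <- s) q t x)) /\
  Rintegral (@mu2 R) D (fun x => \sum_(t <- s) q t x) =
  \sum_(t <- s) Rintegral (@mu2 R) D (q t).
Proof.
move=> mD iq; elim: s => [|t s [iS eS]].
  rewrite (_ : (fun x => _) = cst 0); last by apply/funext => x; rewrite big_nil.
  rewrite big_nil /Rintegral integral0; split => //; exact: integrable0.
rewrite (_ : (fun x => _) = (fun x => q t x + \sum_(t <- s) q t x)); last first.
  by apply/funext => x; rewrite big_cons.
rewrite big_cons RintegralD// eS; split => //.
exact: (integrableD mD (iq t) iS).
Qed.

Lemma integrable_piece q t : continuous (q t) ->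
  (@mu2 R).-integrable (Om : set (plane R)) (EFin \o (q t \_ (tri_set t)°)).
Proof.
move=> cq; have := continuous_integrable2 cq mOm bdOm.
move=> i; rewrite -restrict_EFin.
apply/(integrable_mkcond _ mOm).2; rewrite -patch_setI.
apply/(integrable_mkcond _ _).1; first exact: measurableI.
by apply: integrableS i => //; exact: measurableI.
Qed.

Lemma Rintegral_glue q : (forall t, continuous (q t)) ->
  (@mu2 R).-integrable (Om : set (plane R)) (EFin \o Defs.glue q) /\
  Rintegral (@mu2 R) Om (Defs.glue q) =
  \sum_(t : tri M) Rintegral (@mu2 R) (Om `&` (tri_set t)°) (q t).
Proof.
move=> cq; rewrite glueE.
have [i ->] := @Rintegral_sum Om (index_enum (tri M)) (fun t => q t \_ (tri_set t)°)
  mOm (fun t => integrable_piece (cq t)).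
by split=> //; apply: eq_bigr => t _; rewrite Rintegral_mkcondr.
Qed.

Lemma tri_interior_closure t : (tri_set t)° `<=` closure Om.
Proof.
move=> x /interior_subset /tri_sub tx; rewrite (mesh_cover M).
by exists (tag t).
Qed.

Lemma tri_interior_meets t : (Om `&` (tri_set t)°) !=set0.
Proof.
pose g : R * R := (1 / 3 : R) *: apex t + (1 / 3 : R) *: vert1 t + (1 / 3 : R) *: vert2 t.
have ig : (tri_set t)° g.
  have d0 := tri_det t.
  have e : 1 / 3 + 1 / 3 + 1 / 3 = 1 :> R by lra.
  have [e1 e2 e3] := bary_det (apex t) (vert1 t) (vert2 t) e.
  by apply: triangle_interior => //; rewrite ?e1 ?e2 ?e3 ?mulfK//; lra.
have := tri_interior_closure ig (open_nbhs_nbhs (conj (@open_interior _ (tri_set t)) ig)).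
by [].
Qed.

(** The interior of a triangle and its intersection with [Om] carry the same
integral when the integrand vanishes off [Om], and [glue] is a sum over the
triangles. *)
Lemma Rintegral_glue_vanish q : (forall t, continuous (q t)) ->
  (forall t x, ~ Om x -> q t x = 0) ->
  Rintegral (@mu2 R) Om (Defs.glue q) = \sum_(t : tri M) Rintegral (@mu2 R) (tri_set t) (q t).
Proof.
move=> cq q0; have [_ ->] := Rintegral_glue cq; apply: eq_bigr => t _.
rewrite -(Rintegral_interior_triangle (tri_det t) (cq t)) Rintegral_mkcondl.
apply: eq_Rintegral => x _; rewrite patchE; case: ifPn => // /negP h.
by rewrite q0// => Ox; apply: h; rewrite inE.
Qed.

Lemma L2_glue q : (forall t, continuous (q t)) -> L2 Om (Defs.glue q).
Proof.
move=> cq; rewrite /L2 glueE.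
have p1 : (1 <= 2%:E :> \bar R)%E by rewrite lee_fin; lra.
have [L0 LD] := @Lfun_addr_closed _ _ _ (@mu2 R) 2%:E p1.
rewrite (_ : _ \_ Om = \sum_(t : tri M) (q t \_ (Om `&` (tri_set t)°))).
  apply: (big_ind (fun f => f \in Lfun (@mu2 R) 2%:E)) => // t _.
  apply: L2_piece => //; first exact: measurableI.
  have [K [Kr hK]] := bdOm.
  by exists K; split => // K' KK' x [Ox _]; exact: (hK K' KK' x Ox).
apply/funext => x; rewrite patchE fct_sumE; case: ifPn => [|/negP] xO.
  by apply: eq_bigr => t _; rewrite !patchE in_setI xO.
rewrite big1// => t _; rewrite patchE in_setI ifN//.
by apply/negP => /andP[].
Qed.

End Glue.

(** * Consequences of the vanishing of the form *)

Section Tests.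
Context (R : realType) (Om : set (R * R)) (M : mesh Om) (o : orientation M).
Context (openOm : open Om) (bdOm : bounded_set Om).
Context (k : nat) (v : tri M -> R * R -> R * R) (hv : Vh o k v).
Context (hb : forall q : tri M -> R * R -> R, Qh0 o k q -> bh o v q = 0).
Implicit Types (t d s : tri M) (e : set (R * R)) (x y : R * R).
Implicit Types (q : tri M -> R * R -> R).

Let Cv t : C1v (v t).
Proof. by have [v1 v2 _] := hv; split; [exact: is_poly_C1 (v1 t)|exact: is_poly_C1 (v2 t)]. Qed.

(** An interior primal edge has a second triangle by [primal_neighbour] and no third
one by [primal_unique]. *)
Lemma interior_jump e : interior_primal_edges M e ->
  exists t d, [/\ t != d, primal t = e, primal d = e &
    forall q x, jump o e q x = q t x - q d x].
Proof.
move=> [[s _ sE] nb].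
have he : (primal_edges M `|` dual_edges M) e by left; exists s.
pose t := tau_plus o e.
have tE : primal t = e.
  have := orient_edge o he; rewrite -/t -sE -/(primal s).
  by move/tri_edge_primal.
have [|d dt dE] := @primal_neighbour _ _ M t openOm; first by rewrite tE.
exists t, d; rewrite eq_sym; split => //; first by rewrite dE.
move=> q x; apply: jump_pair => //; last by rewrite eq_sym.
move=> s'; split.
  rewrite -tE => /tri_edge_primal E; have [->|ne] := eqVneq s' t; first by left.
  by right; apply: primal_unique ne dt _ dE.
by case=> ->; apply: Or31; rewrite -?tE -?dE.
Qed.

Lemma jump_shift d q (c : R) x :
  jump o (dual_edge d) (fun t y => q t y - c) x = jump o (dual_edge d) q x.
Proof.
have [j1 j2] := jump_dual o d (fun t y => q t y - c) x.
have [k1 k2] := jump_dual o d q x.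
have [[E _]|[E _]] := dual_plus o d.
  by rewrite j1// k1//; ring.
by rewrite j2// k2//; ring.
Qed.

Lemma bh_shift q (c : R) : (forall t, C1 (q t)) ->
  bh o v (fun t y => q t y - c) = bh o v q.
Proof.
move=> Cq; apply: (congr2 (fun a b : R => - a + b)).
  apply: eq_bigr => t _; apply: eq_Rintegral => x _; congr (dot _ _).
  have [_ e1 e2] := C1_add (Cq t) (C1_cst (- c)).
  rewrite /grad; congr pair.
    apply: etrans (congr1 (@^~ x) e1) _ => /=.
    by rewrite [X in _ + X]derive_cst addr0.
  apply: etrans (congr1 (@^~ x) e2) _ => /=.
  by rewrite [X in _ + X]derive_cst addr0.
apply: eq_bigr => d _; congr (seg_int _ _ _); apply/funext => x /=.
by rewrite jump_shift.
Qed.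

(** The argument [t] says that the mesh has a triangle. *)
Lemma Rintegral_glue1 t : 0 < Rintegral (@mu2 R) Om (Defs.glue (fun (_ : tri M) _ => 1)).
Proof.
have [_ ->] := Rintegral_glue openOm bdOm (fun _ : tri M => @cst_continuous _ _ (1 : R)).
have mI s : measurable (Om `&` (tri_set s)° : set (plane R)).
  by apply: measurable_open; apply: openI => //; exact: open_interior.
have E s : Rintegral (@mu2 R) (Om `&` (tri_set s)°) (fun=> 1) =
    fine ((@mu2 R) (Om `&` (tri_set s)° : set (plane R))).
  by rewrite Rintegral_cst// mul1r.
rewrite (bigD1 t) //=; apply: ltr_pwDl; last first.
  by apply: sumr_ge0 => s _; rewrite E fine_ge0// measure_ge0.
rewrite E; apply: fine_gt0; apply/andP; split.
  apply: mu2_open_gt0; last exact: tri_interior_meets.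
  by apply: openI => //; exact: open_interior.
have [K OK] := bounded_square bdOm.
apply: le_lt_trans (square_finite K); apply: le_measure; rewrite ?inE //.
  exact: measurable_square.
by move=> x [Ox _]; exact: OK.
Qed.

(** Subtracting the mean changes neither membership in [Qh] nor [bh]. *)
Lemma bh_Qh t q : Qh o k q -> bh o v q = 0.
Proof.
move=> [Pq Jq].
have Cq s : C1 (q s) by exact: is_poly_C1 (Pq s).
have cq s : continuous (q s) by exact: C1_cts.
pose c := Rintegral (@mu2 R) Om (Defs.glue q) /
  Rintegral (@mu2 R) Om (Defs.glue (fun (_ : tri M) _ => 1)).
rewrite -(bh_shift c Cq); apply: hb; split; [split|].
- move=> s; apply: is_poly_add; first exact: Pq.
  exact: is_poly_cst.
- move=> e ie x xe; have [s [d [_ _ _ j]]] := interior_jump ie.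
  have := Jq e ie x xe; rewrite !j => h.
  by rewrite -h; ring.
have c1 s : continuous (fun _ : R * R => (1 : R)) by exact: cst_continuous.
have cqc s : continuous (fun x => q s x - c).
  by move=> x; apply: cvgB; [exact: cq|exact: cvg_cst].
have g1 := Rintegral_glue1 t.
have [_ e1] := Rintegral_glue openOm bdOm c1.
have [_ e2] := Rintegral_glue openOm bdOm cq.
have [_ ->] := Rintegral_glue openOm bdOm cqc.
transitivity (Rintegral (@mu2 R) Om (Defs.glue q) -
  c * Rintegral (@mu2 R) Om (Defs.glue (fun (_ : tri M) _ => 1))); last first.
  by rewrite /c divfK ?subrr// gt_eqF.
rewrite e2 e1 mulr_sumr -sumrB; apply: eq_bigr => s _.
have mI : measurable (Om `&` (tri_set s)° : set (plane R)).
  by apply: measurable_open; apply: openI => //; exact: open_interior.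
have iI (f : R * R -> R) : continuous f ->
    (@mu2 R).-integrable (Om `&` (tri_set s)° : set (plane R)) (EFin \o f).
  move=> cf; apply: continuous_integrable2 => //.
  have [K [Kr hK]] := bdOm.
  by exists K; split => // K' KK' x [Ox _]; exact: (hK K' KK' x Ox).
rewrite RintegralB; [|exact: mI|exact: iI|exact/iI/cst_continuous].
congr (_ - _); rewrite -RintegralZl; [|exact: mI|exact/iI/cst_continuous].
by apply: eq_Rintegral => x _; rewrite mulr1.
Qed.

(** The integral of the square of [f + s r] is nonnegative and, the quadratic term
being zero, affine in [s]; hence it is constant. *)
Lemma lint_sq0 (a b : R * R) (r f : R * R -> R) : continuous r -> continuous f ->
  lint a b (fun x => r x * r x) = 0 -> lint a b (fun x => r x * f x) = 0.
Proof.
move=> cr cf r0.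
have crr : continuous (fun x => r x * r x) by move=> x; apply: cvgM; exact: cr.
have cff : continuous (fun x => f x * f x) by move=> x; apply: cvgM; exact: cf.
have crf : continuous (fun x => r x * f x).
  by move=> x; apply: cvgM; [exact: cr|exact: cf].
have cZ (c : R) (g : R * R -> R) : continuous g -> continuous (fun x => c * g x).
  by move=> cg x; apply: cvgMl_tmp; exact: cg.
set F := lint a b (fun x => f x * f x); set B := lint a b (fun x => r x * f x).
have pos (s : R) : 0 <= F + 2 * s * B.
  have : 0 <= lint a b (fun x => f x * f x + 2 * s * (r x * f x) + s ^+ 2 * (r x * r x)).
    have sq y : 0 <= f y * f y + 2 * s * (r y * f y) + s ^+ 2 * (r y * r y).
      by rewrite (_ : _ + _ = (f y + s * r y) ^+ 2) ?sqr_ge0//; ring.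
    by apply: Rintegral_ge0 => t _; exact: sq.
  rewrite lintD; [|by move=> x; apply: cvgD; [exact: cff|exact: cZ]|exact: cZ].
  by rewrite lintD ?lintZ// ?r0 ?mulr0 ?addr0//; exact: cZ.
apply/eqP; apply: contraT => B0.
(* at this value of [s] the affine function is -1 *)
have := pos (- (F + 1) / (2 * B)).
rewrite (_ : 2 * _ * B = - (F + 1)); last by field.
lra.
Qed.

(** The divergence times the barycentric coordinate [L] of the apex is a test
function: it has degree at most [k] and vanishes on the primal edge. Testing
with it gives the integral of the squared divergence with the weight [L], which
on the triangle is positive off a line. *)
Lemma div_zero t (f : R * R -> R) : continuous f ->
  Rintegral (@mu2 R) (tri_set t) (fun x => divg (v t) x * f x) = 0.
Proof.
move=> cf.
have d0 := tri_det t; set D := det (apex t) (vert1 t) (vert2 t) in d0.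
pose L x := det x (vert1 t) (vert2 t) / D.
have cL : continuous L by move=> x; apply: cvgMr_tmp; exact: cts_det1.
have cg : continuous (divg (v t)) by exact: cts_divg.
pose q s x := if s == t then L x * divg (v t) x else 0.
have Pq : Pk k q.
  move=> s; rewrite /q; case: eqP => [_|_]; last exact: is_poly0.
  have [v1 v2 _] := hv.
  pose A := ((vert1 t).2 - (vert2 t).2) / D.
  pose B := ((vert2 t).1 - (vert1 t).1) / D.
  pose C := ((vert1 t).1 * (vert2 t).2 - (vert1 t).2 * (vert2 t).1) / D.
  have [_ [p1 _]] := affine_derive_poly A B C (v1 t).
  have [_ [_ p2]] := affine_derive_poly A B C (v2 t).
  rewrite (_ : (fun x => _) = (fun x =>
    (A * x.1 + B * x.2 + C) * 'D_(1, 0) (fun y => (v t y).1) x +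
    (A * x.1 + B * x.2 + C) * 'D_(0, 1) (fun y => (v t y).2) x)).
    exact: is_poly_add.
  apply/funext => x; rewrite -mulrDr; congr (_ * _).
  by rewrite /L /det /A /B /C; field.
have L0 x : primal t x -> L x = 0.
  move=> [s _ ->]; rewrite /L (_ : det _ _ _ = 0) ?mul0r//.
  by rewrite /det !coordE; ring.
have Qq : Qh o k q.
  split=> // e ie x xe; have [s [d [_ sE dE ->]]] := interior_jump ie.
  have z s' : primal s' = e -> q s' x = 0.
    by rewrite /q; case: eqP => // -> tE; rewrite L0 ?mul0r// tE.
  by rewrite !z ?subrr.
have Cq s : C1 (q s) by exact: is_poly_C1 (Pq s).
have := bh_Qh t Qq; rewrite (bh_parts hv Cq) (bigD1 t)//= [X in _ + X]big1 ?addr0; last first.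
  move=> s st; rewrite /q (negbTE st) /primal_flux lint0 ?subr0; last by move=> x _; rewrite mulr0.
  rewrite (_ : (fun x => _) = cst 0) ?Rintegral_cst ?mul0r//; last by apply/funext => x; rewrite mulr0.
  by apply: measurable_triangle; exact: tri_det.
rewrite {2}/q eqxx [primal_flux _ _ _]lint0 ?subr0; last by move=> x xe; rewrite L0// mul0r mulr0.
rewrite /q eqxx.
pose h x := divg (v t) x * (L x * divg (v t) x).
have ch : continuous h.
  by move=> x; apply: cvgM; [exact: cg|apply: cvgM; [exact: cL|exact: cg]].
have mT : measurable (tri_set t : set (plane R)) by exact: measurable_triangle.
have ih := integrable_triangle d0 ch.
move=> h0.
have h0' : (\int[leb R \x leb R]_(x in (tri_set t : set (plane R))) `|(h x)%:E| = 0)%E.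
  rewrite -[RHS]/((0 : R)%:E) -h0 /Rintegral fineK; last exact: integrable_fin_num ih.
  apply: eq_integral => x; rewrite inE => /(triangleP x d0) [Lx _ _] /=.
  rewrite ger0_norm// /h mulrCA -expr2; apply: mulr_ge0 => //; exact: sqr_ge0.
move/integrableP: (ih) => [mh _].
have /(ae_eq_integral_abs _ mT mh) ae := h0'.
have cdf : continuous (fun x => divg (v t) x * f x).
  by move=> x; apply: cvgM; [exact: cg|exact: cf].
rewrite /Rintegral (@ae_eq_integral _ _ _ (leb R \x leb R)%E _ (cst 0%E)) //.
- by rewrite integral0.
- exact: measurable_int (integrable_triangle d0 cdf).
have ln : {ae (leb R \x leb R)%E, forall x : plane R, det x (vert1 t) (vert2 t) != 0}.
  exists [set x | det x (vert1 t) (vert2 t) = 0]; split.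
  - exact: measurable_line.
  - by apply: mu2_line; exact: verts_neq.
  - by move=> x /= /negP; rewrite negbK => /eqP.
apply: (@filterS2 _ _ (ae_filter_ringOfSetsType (leb R \x leb R)%E) _ _ _ _ ae ln).
move=> x hx nx xt; have := hx xt; rewrite /h /= => -[/eqP].
rewrite !mulf_eq0 orbCA orbb invr_eq0 (negbTE nx) (negbTE d0) /= => /eqP ->.
by rewrite mul0r.
Qed.

(** Testing with the flux jump of the edge, extended to both triangles as a
polynomial, shows that this jump vanishes. *)
Lemma flux_pair t d (f : R * R -> R) : t != d -> primal t = primal d ->
  continuous f -> primal_flux v t f + primal_flux v d f = 0.
Proof.
move=> td tdE cf.
pose r x := dot (v t x) (out_normal t) + dot (v d x) (out_normal d).
pose m s := (s == t) || (s == d).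
pose q s x := if m s then r x else 0.
have Pr : is_poly k r.
  have [v1 v2 _] := hv.
  have dp s : is_poly k (fun x => dot (v s x) (out_normal s)).
    rewrite (_ : (fun x => _) = (fun x => (out_normal s).1 * (v s x).1 +
      (out_normal s).2 * (v s x).2)).
      by apply: is_poly_add; apply: is_poly_scale; [exact: v1|exact: v2].
    by apply/funext => x; rewrite /dot; ring.
  exact: is_poly_add (dp t) (dp d).
have Pq : Pk k q.
  by move=> s; rewrite /q; case: (m s); [exact: Pr|exact: is_poly0].
have mP s s' : s' != s -> primal s' = primal s -> m s -> m s'.
  move=> ss sE /orP[] /eqP E; rewrite {}E in ss sE; apply/orP; [right|left]; apply/eqP.
    by apply: (primal_unique ss _ sE (esym tdE)); rewrite eq_sym.
  exact: (primal_unique ss td sE tdE).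
have Qq : Qh o k q.
  split=> // e ie x xe; have [s [s' [ss sE sE' ->]]] := interior_jump ie.
  have -> : q s x = q s' x; last by rewrite subrr.
  have EE := etrans sE (esym sE').
  rewrite /q (_ : m s = m s')//; apply/idP/idP; apply: mP => //.
  by rewrite eq_sym.
have cr : continuous r by apply: C1_cts; exact: is_poly_C1 Pr.
have Cq s : C1 (q s) by exact: is_poly_C1 (Pq s).
have cE s : continuous (fun x => dot (v s x) (out_normal s)) by exact: cts_dot.
have flip (g : R * R -> R) : continuous g ->
    lint (vert1 d) (vert2 d) g = lint (vert1 t) (vert2 t) g.
  by move=> cg; apply: lint_seg => //; exact: verts_neq.
have sumE (g : R * R -> R) : continuous g -> primal_flux v t g + primal_flux v d g =
    lint (vert1 t) (vert2 t) (fun x => r x * g x).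
  move=> cg; rewrite /primal_flux flip; last exact: cts_flux.
  rewrite -lintD; [|exact: cts_flux..].
  by apply: eq_lint => x _ /=; rewrite /r /=; ring.
rewrite sumE//; apply: lint_sq0 => //; rewrite -sumE//.
pose G s := Rintegral (@mu2 R) (tri_set s) (fun x => divg (v s) x * q s x) -
  primal_flux v s (q s).
have GE s : G s = - primal_flux v s (q s).
  by rewrite /G div_zero ?sub0r//; exact: C1_cts.
have G0 s : ~~ m s -> G s = 0.
  move=> ms; rewrite GE /primal_flux lint0 ?oppr0// => x _.
  by rewrite /q (negbTE ms) mulr0.
have Gr s : m s -> G s = - primal_flux v s r.
  by move=> ms; rewrite GE /q ms.
have : \sum_(s : tri M) G s = 0 by rewrite -(bh_parts hv Cq); exact: bh_Qh.
rewrite (bigD1 t) //= (bigD1 d) /=; last by rewrite eq_sym.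
rewrite big1; last by move=> s /andP[st sd]; rewrite G0// /m negb_or st sd.
have mt : m t by rewrite /m eqxx.
have md : m d by rewrite /m eqxx orbT.
rewrite (Gr t mt) (Gr d md).
by move: (primal_flux v t r) (primal_flux v d r) => x y ?; lra.
Qed.

(** After integration by parts only the primal fluxes remain. They cancel in pairs of
neighbours, and a triangle without neighbour has its primal edge on the boundary
of [Om], where [f] vanishes. *)
Lemma bh_smooth (f : R * R -> R) : C1 f -> (forall x, ~ Om x -> f x = 0) ->
  bh o v (fun _ => f) = 0.
Proof.
move=> Cf f0; have cf := C1_cts Cf.
rewrite (bh_parts hv (fun=> Cf)).
(* the neighbour across the primal edge, or [t] itself if there is none *)
pose nb t := odflt t [pick d | (d != t) && `[< primal d = primal t >]].
have nbP t : (nb t != t /\ primal (nb t) = primal t) \/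
    (nb t = t /\ forall d, d != t -> primal d <> primal t).
  rewrite /nb; case: pickP => [d /andP[dt /asboolP E]|no]; [by left|right].
  by split=> // d dt E; have := no d; rewrite dt /= => /asboolP.
have nbK : involutive nb.
  move=> t; have [[n1 e1]|[n1 no1]] := nbP t; last by rewrite !n1.
  have [[n2 e2]|[n2 no2]] := nbP (nb t).
    by apply: (primal_unique n2 _ e2 (esym e1)); rewrite eq_sym.
  by exfalso; apply: (no2 t); rewrite 1?eq_sym.
have pair0 t : primal_flux v t f + primal_flux v (nb t) f = 0.
  have [[n1 e1]|[n1 no1]] := nbP t.
    by apply: flux_pair => //; rewrite 1?eq_sym.
  have bd : primal t `<=` bnd Om.
    apply: contrapT => nbd; have [d dt dE] := primal_neighbour openOm nbd.
    exact: no1 dt dE.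
  rewrite n1 /primal_flux lint0 ?addr0// => x /bd [_ nx].
  by rewrite f0 ?mulr0// => Ox; apply: nx; exact: open_nbhs_nbhs (conj openOm Ox).
under eq_bigr do rewrite div_zero// sub0r.
rewrite sumrN; apply/eqP; rewrite oppr_eq0.
have : \sum_(t : tri M) primal_flux v t f + \sum_(t : tri M) primal_flux v t f = 0.
  rewrite {2}(reindex_inj (inv_inj nbK)) -big_split /=.
  by rewrite big1.
by move/eqP; rewrite -mulr2n mulrn_eq0.
Qed.

Lemma grad_off (f : R * R -> R) x : ~ closure [set y | f y != 0] x ->
  f x = 0 /\ grad f x = 0.
Proof.
move=> nx.
have N : nbhs x (~` closure [set y | f y != 0]).
  by apply: open_nbhs_nbhs; split=> //; apply: closed_openC; exact: closed_closure.
have f0 y : ~ closure [set y | f y != 0] y -> f y = 0.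
  move=> ny; apply/eqP; apply: contraT => fy; exfalso; apply: ny.
  exact: subset_closure.
have D u : 'D_u f x = 0.
  rewrite (near_eq_derive (g := cst 0)) ?derive_cst//.
  by apply: filterS N => y /f0.
by split; [exact: f0|rewrite /grad !D].
Qed.

(** A test function has no jumps, so only the integral against its gradient is left
of [bh], and it is zero by [bh_smooth]. *)
Lemma weak_div_zero : weak_div Om (glue_vec v) (fun=> 0).
Proof.
move=> f [Cf cpt supp].
have C1f : C1 f.
  have [df dD] := Cf 2; split=> // x.
    by apply: differentiable_continuous; have [+ _] := dD (1, 0); exact.
  by apply: differentiable_continuous; have [+ _] := dD (0, 1); exact.
have off x : ~ Om x -> f x = 0 /\ grad f x = 0.
  by move=> nO; apply: grad_off => /supp.
rewrite [in RHS](_ : (fun x => _) = cst 0); last by apply/funext => x; rewrite mul0r.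
rewrite {2}/Rintegral integral0 oppr0.
pose q t x := dot (v t x) (grad f x).
have -> : (fun x => dot (glue_vec v x) (grad f x)) = Defs.glue q.
  apply/funext => x; rewrite /glue_vec /Defs.glue /q /dot /= !mulr_suml -big_split.
  by [].
have cq t : continuous (q t).
  have [_ g1 g2] := C1f; have [c1 c2] := Cv t.
  by move=> x; apply: cvgD; apply: cvgM;
    [exact: (C1_cts c1)|exact: g1|exact: (C1_cts c2)|exact: g2].
rewrite Rintegral_glue_vanish//; last first.
  by move=> t x /off[_ g0]; rewrite /q g0 /dot mulr0 mulr0 addr0.
have := bh_smooth C1f (fun x nO => (off x nO).1); rewrite /bh.
rewrite [X in _ + X]big1 ?addr0.
  by move/eqP; rewrite oppr_eq0 => /eqP.
move=> d _; have j0 x : jump o (dual_edge d) (fun _ => f) x = 0.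
  have [j1 j2] := jump_dual o d (fun _ => f) x.
  by have [[E _]|[E _]] := dual_plus o d; [rewrite j1|rewrite j2]; rewrite // subrr.
have z : lint (apex d) (vert1 d) (fun x => dot (v (tau_plus o (dual_edge d)) x)
    (nrm o (dual_edge d)) * jump o (dual_edge d) (fun _ => f) x) = 0.
  by apply: lint0 => x _; rewrite j0 mulr0.
by apply: etrans (congr1 ( *%R (eucl (vert1 d - apex d))) z) (mulr0 _).
Qed.

End Tests.

Theorem lemma2p11 (R : realType) (Om : set (R * R)) (hOm : polygonal_domain Om)
  (M : mesh Om) (o : orientation M) (k : nat)
  (vh : tri M -> R * R -> R * R) (hvh : Vh o k vh)
  (hb : forall q : tri M -> R * R -> R, Qh0 o k q -> bh o vh q = 0) :
  Hdiv Om (glue_vec vh) /\ weak_div Om (glue_vec vh) (fun=> 0).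
Proof.
have [[_ oOm] bOm _ _ _] := hOm; have [v1 v2 _] := hvh.
have wd := weak_div_zero oOm bOm hvh hb.
split=> //; split.
- by apply: L2_glue => // t; apply: C1_cts; exact: is_poly_C1 (v1 t).
- by apply: L2_glue => // t; apply: C1_cts; exact: is_poly_C1 (v2 t).
exists (fun=> 0) => //.
by apply: L2_piece => //; [exact: cst_continuous|exact: measurable_open].
Qed.
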